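(* Let $1 < \alpha < 2$ and $-\infty < \beta < \infty$. Let $X, X_1, X_2, \ldots$ be independent identically distributed real-valued random variables and $S_n = X_1 + \cdots + X_n$, $n \ge 1$. Then $$\limsup_{n \rightarrow \infty} \left| \frac{S_{n}}{n^{1/\alpha}} \right|^{(\log \log n)^{-1}} = e^{\beta} \quad \text{almost surely}$$ if and only if $$\mathbb{E}X = 0 \quad\text{and}\quad \inf \left\{b \in \mathbb{R}:~ \mathbb{E} \left(\frac{|X|^{\alpha}}{(L|X|)^{b\alpha}} \right) < \infty \right\} = \beta.$$
   Context: $\log$ is the natural logarithm and $Lx = \log(\max(e, x))$ for $x \ge 0$. The quantity $|\cdot|^{(\log\log n)^{-1}}$ is considered for $n \ge 3$. The infimum is taken in the extended reals over real $b$, with the infimum of the empty set equal to $+\infty$. The condition $\mathbb{E}X = 0$ includes that $\mathbb{E}X$ exists. *)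

(* Defs.v *)
From HB Require Import structures.
From mathcomp Require Import all_boot all_order all_algebra finmap.
From mathcomp Require Import all_classical all_reals all_analysis.
Set Implicit Arguments.
Unset Strict Implicit.
Unset Printing Implicit Defensive.
Import Order.TTheory GRing.Theory Num.Theory.
Import numFieldNormedType.Exports.
Local Open Scope classical_set_scope.
Local Open Scope ring_scope.

Definition mutually_independent (d : measure_display) (T : measurableType d)
    (R : realType) (P : probability T R) (I : choiceType)
    (X : I -> {RV P >-> R}) : Prop :=
  forall (J : {fset I}) (B : I -> set R),
    (forall i, i \in J -> measurable (B i)) ->
    P (\bigcap_(i in [set` J]) (X i @^-1` B i)) =
    (\prod_(i <- J) P (X i @^-1` B i))%E.

(* Laws are compared on measurable sets only: the value of a measure on a
   non-measurable set carries no meaning. *)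
Definition identically_distributed (d : measure_display)
    (T : measurableType d) (R : realType) (P : probability T R)
    (I : choiceType) (X : I -> {RV P >-> R}) : Prop :=
  forall (i j : I) (B : set R), measurable B ->
    distribution P (X i) B = distribution P (X j) B.

Definition iid (d : measure_display) (T : measurableType d) (R : realType)
    (P : probability T R) (I : choiceType) (X : I -> {RV P >-> R}) : Prop :=
  mutually_independent X /\ identically_distributed X.

(* A sequence [X] indexed by [nat] encodes the family X, X_1, X_2, ...: the
   term [X 0%N] is the generic copy X and does not enter the partial sums. *)
Definition partial_sum (d : measure_display) (T : measurableType d)
    (R : realType) (P : probability T R) (X : nat -> {RV P >-> R})
    (n : nat) (w : T) : R :=
  \sum_(1 <= i < n.+1) X i w.

Definition Llog (R : realType) (x : R) : R := ln (Num.max (expR 1) x).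

(* Main.v *)
Require Import Defs.
From HB Require Import structures.
From mathcomp Require Import all_boot all_order all_algebra finmap.
From mathcomp Require Import all_classical all_reals all_analysis.
From mathcomp Require Import measurable_realfun.
From mathcomp Require Import ring lra.
Set Implicit Arguments.
Unset Strict Implicit.
Unset Printing Implicit Defensive.
Import Order.TTheory GRing.Theory Num.Theory.
Import numFieldNormedType.Exports.
Local Open Scope classical_set_scope.
Local Open Scope ring_scope.

(** Write [a n] for the norming sequence n^(1/alpha) (log n)^b and [g] for
    the moment function z^alpha / (log z)^(b alpha).  The exponent
    1 / log (log n) turns the factor (log n)^b into e^b and erases constants,
    so an upper limit equal to e^beta means that beta is the threshold between
    the exponents [b] for which S_n = O(a n) and the others.  The two functions
    are inverse to each other up to constants ([moment_norming]), hence
    E g(|X|) is finite exactly when the sum of P(|X| > a n) over n converges.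

    If E g(|X|) is finite and X has mean mu, then S_n - n mu = O(a n) almost
    surely: this is the law of Marcinkiewicz and Zygmund with a logarithmic
    factor ([marcinkiewicz_zygmund]).  On the dyadic block n <= 2^j the
    variables are truncated at [a (2^j)]; the truncated sums are controlled by
    a maximal inequality ([maximal_inequality]), obtained from Ottaviani's
    inequality and Chebyshev's, and the resulting bounds are summable in [j]
    because 2^j / a(2^j)^2 decays geometrically (here alpha < 2) while 2^j
    grows geometrically ([dyadic_second_moment_sum], [dyadic_tail_sum]).  The
    drift caused by truncation is O(a n) because alpha > 1.

    If E g(|X|) is infinite, the second Borel-Cantelli lemma gives
    |X_n| > C a(n) infinitely often for every C; as X_n is the difference of
    two successive partial sums, |S_n| > a n infinitely often
    ([partial_sums_exceed]).

    Finally, if the upper limit is finite then E g(|X|) is finite for large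
    [b], so X is integrable, both S_n and S_n - n mu are O(a n), and mu = 0
    because a n = o(n) ([mean_zero]). *)

(** * Powers times logarithms *)

Section slowly_varying.
Context {R : realType}.
Implicit Types (x y z u s t p K : R).

Lemma Llog_ge1 x : 1 <= Llog x.
Proof.
have e0 := @expR_gt0 R 1.
rewrite -[leLHS]expRK /Llog ler_ln ?posrE ?le_max ?lexx//.
by rewrite lt_max e0.
Qed.

Lemma Llog_gt0 x : 0 < Llog x.
Proof. exact: lt_le_trans (Llog_ge1 x). Qed.

Lemma Llog_ge0 x : 0 <= Llog x.
Proof. exact/ltW/Llog_gt0. Qed.

Lemma ler_Llog x y : x <= y -> Llog x <= Llog y.
Proof.
move=> xy; rewrite /Llog ler_ln ?posrE ?lt_max ?expR_gt0//.
by rewrite ge_max !le_max lexx xy orbT.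
Qed.

Lemma Llog_ln x : expR 1 <= x -> Llog x = ln x.
Proof. by move=> ex; rewrite /Llog max_r. Qed.

Lemma ln_le_Llog x : 0 < x -> ln x <= Llog x.
Proof.
by move=> x0; rewrite /Llog ler_ln ?posrE ?lt_max ?x0 ?orbT// le_max lexx orbT.
Qed.

(** Slow variation of the logarithm, in quantitative form. *)
Lemma LlogM x u : 0 <= x -> 1 <= u -> Llog (x * u) <= Llog x * (1 + ln u).
Proof.
move=> x0 u1; have u0 : 0 < u by lra.
have lu := ln_ge0 u1.
apply: (@le_trans _ _ (Llog x + ln u)); last first.
  by rewrite mulrDr mulr1 lerD2l ler_peMl// Llog_ge1.
have M0 : 0 < Num.max (expR 1) x by rewrite lt_max expR_gt0.
have Mu0 : 0 < Num.max (expR 1) x * u by rewrite mulr_gt0.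
rewrite -lnM ?posrE// /Llog ler_ln ?posrE ?lt_max ?expR_gt0//.
rewrite ge_max; apply/andP; split.
  by rewrite -[leLHS]mulr1 ler_pM ?expR_ge0// le_max lexx.
by rewrite ler_pM2r// le_max lexx orbT.
Qed.

Lemma Llog_powR x p : 0 < x -> 0 <= p ->
  Llog (x `^ p) <= Num.max 1 p * Llog x.
Proof.
move=> x0 p0; have m1 : 1 <= Num.max 1 p by rewrite le_max lexx.
have L1 := Llog_ge1 x.
have H : 1 <= Num.max 1 p * Llog x by rewrite -[leLHS]mulr1 ler_pM.
rewrite -[leRHS]expRK {1}/Llog ler_ln ?posrE ?lt_max ?expR_gt0//.
rewrite ge_max ler_expR H/= /powR gt_eqF// ler_expR.
rewrite (@le_trans _ _ (p * Llog x)) ?ler_wpM2l ?ln_le_Llog//.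
by rewrite ler_pM2r ?Llog_gt0// le_max lexx orbT.
Qed.

(** Comparability up to [K] survives a power of either sign, which lets the
    lemmas below treat positive and negative powers of the logarithm alike. *)
Lemma powR_ratio x y K p : 0 < x -> 0 < y -> 1 <= K -> x <= K * y ->
  y <= K * x -> x `^ p <= K `^ `|p| * y `^ p.
Proof.
move=> x0 y0 K1 xy yx; have K0 : 0 < K by lra.
rewrite -ler_ln ?posrE ?mulr_gt0 ?powR_gt0// lnM ?posrE ?powR_gt0// !ln_powR.
have lK := ln_ge0 K1.
move: xy yx; rewrite -ler_ln ?posrE ?mulr_gt0// lnM// => xy.
rewrite -ler_ln ?posrE ?mulr_gt0// lnM// => yx.
have [p0|p0] := leP 0 p.
  by rewrite ger0_norm//; nra.
by rewrite ltr0_norm//; nra.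
Qed.

Definition powlog s t x : R := x `^ s * Llog x `^ t.

Lemma powlog_ge0 s t x : 0 <= powlog s t x.
Proof. by rewrite mulr_ge0 ?powR_ge0. Qed.

Lemma powlog_gt0 s t x : 0 < x -> 0 < powlog s t x.
Proof. by move=> x0; rewrite mulr_gt0 ?powR_gt0// Llog_gt0. Qed.

Lemma powlog0 s t : s != 0 -> powlog s t 0 = 0.
Proof. by move=> s0; rewrite /powlog powR0// mul0r. Qed.

Lemma powlogM s t s' t' x : 0 < x ->
  powlog s t x * powlog s' t' x = powlog (s + s') (t + t') x.
Proof.
move=> x0; rewrite /powlog mulrACA -!powRD//.
  by rewrite (gt_eqF (Llog_gt0 x)) implybT.
by rewrite (gt_eqF x0) implybT.
Qed.

Lemma powlogV s t x : 0 < x -> (powlog s t x)^-1 = powlog (- s) (- t) x.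
Proof. by move=> x0; rewrite /powlog !powRN invfM. Qed.

Lemma powlogX s t x p : powlog s t x `^ p = powlog (s * p) (t * p) x.
Proof. by rewrite /powlog powRM ?powR_ge0// !powRrM. Qed.

Lemma measurable_Llog : measurable_fun [set: R] (@Llog R).
Proof.
by apply: measurableT_comp => //; apply: measurable_maxr.
Qed.

Lemma measurable_powlog s t : measurable_fun [set: R] (powlog s t).
Proof.
apply: measurable_funM; first exact: measurable_powR.
by apply: (measurableT_comp (measurable_powR _)); exact: measurable_Llog.
Qed.

Lemma ln_le_powR x p : 0 < p -> 0 < x -> ln x <= p^-1 * x `^ p.
Proof.
move=> p0 x0; rewrite -(ler_pM2l p0) mulrA divff ?gt_eqF// mul1r -ln_powR.
by rewrite ltW// ln_sublinear// powR_gt0.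
Qed.

(** Any positive power of x beats any power of its logarithm, so [powlog s t]
    increases up to a constant even where it is not monotone.  For [t < 0] and
    y = x u the quotient of the logarithms is at most 1 + log u, which is
    O(u^p) for every p > 0; p is chosen so that p (- t) = s. *)
Lemma powlog_incr s t : 0 < s ->
  exists2 K, 0 < K & forall x y, 0 <= x -> x <= y ->
    powlog s t x <= K * powlog s t y.
Proof.
move=> s0; have [t0|t0] := leP 0 t.
  exists 1 => // x y x0 xy; rewrite mul1r ler_pM ?powR_ge0//.
    by apply: ge0_ler_powR; rewrite ?nnegrE ?(ltW s0) ?(le_trans x0).
  by apply: ge0_ler_powR; rewrite ?nnegrE ?Llog_ge0// ler_Llog.
pose p := s / (- t).
have p0 : 0 < p by rewrite divr_gt0// oppr_gt0.
have K0 : 0 < 1 + p^-1 by rewrite addr_gt0// invr_gt0.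
exists ((1 + p^-1) `^ (- t)); first by rewrite powR_gt0.
move=> x y; rewrite le_eqVlt => /predU1P[<- y0|x0 xy].
  by rewrite powlog0 ?gt_eqF// mulr_ge0 ?powR_ge0// powlog_ge0.
have y0 : 0 < y by apply: lt_le_trans xy.
pose u := y / x.
have u1 : 1 <= u by rewrite ler_pdivlMr// mul1r.
have u0 : 0 < u by lra.
have yE : y = x * u by rewrite mulrC divfK// gt_eqF.
have LL : Llog y <= Llog x * ((1 + p^-1) * u `^ p).
  rewrite yE (le_trans (LlogM (ltW x0) u1))// ler_wpM2l ?Llog_ge0//.
  rewrite mulrDl mul1r lerD ?ln_le_powR//.
  by rewrite -[leLHS](powRr0 u) ler_powR// ltW.
rewrite /powlog {1}yE powRM ?(ltW x0) ?(ltW u0)//.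
have -> : u `^ s = (u `^ p) `^ (- t) by rewrite -powRrM divfK// gt_eqF// oppr_gt0.
set A := (1 + p^-1) `^ (- t).
rewrite [leRHS](_ : _ = x `^ s * (A * (u `^ p) `^ (- t) * Llog y `^ t)); last by ring.
rewrite ler_wpM2l ?powR_ge0// /A -powRM ?powR_ge0 ?(ltW K0)//.
rewrite -[t in leLHS]opprK -[t in X in _ * X]opprK 2!(powRN _ (- t)).
rewrite ler_pdivlMr ?powR_gt0 ?Llog_gt0//.
rewrite mulrC ler_pdivrMr ?powR_gt0 ?Llog_gt0//.
rewrite -powRM ?mulr_ge0 ?powR_ge0 ?Llog_ge0 ?(ltW K0)//.
apply: ge0_ler_powR; rewrite ?nnegrE ?Llog_ge0 ?mulr_ge0 ?powR_ge0 ?Llog_ge0 ?(ltW K0)//.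
  by rewrite oppr_ge0 ltW.
by rewrite [leRHS]mulrC.
Qed.

Lemma powlog_decr s t : s < 0 ->
  exists2 K, 0 < K & forall x y, 0 < x -> x <= y ->
    powlog s t y <= K * powlog s t x.
Proof.
move=> s0; have [|K K0 KP] := @powlog_incr (- s) (- t); first by rewrite oppr_gt0.
exists K => // x y x0 xy; have y0 : 0 < y by apply: lt_le_trans xy.
have := KP x y (ltW x0) xy; rewrite -!powlogV// => H.
have px := powlog_gt0 s t x0; have py := powlog_gt0 s t y0.
by move: H; rewrite ler_pdivlMr// mulrC ler_pdivrMr.
Qed.

Lemma powlog_scale s t K : 1 <= K ->
  exists2 K', 0 < K' & forall x, 0 <= x ->
    powlog s t (K * x) <= K' * powlog s t x.
Proof.
move=> K1; have lK := ln_ge0 K1; have K0 : 0 < K by lra.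
exists (K `^ s * (1 + ln K) `^ `|t|).
  by rewrite mulr_gt0 ?powR_gt0//; lra.
move=> x x0; rewrite /powlog powRM ?(ltW K0)//.
rewrite [leRHS](_ : _ = K `^ s * x `^ s * ((1 + ln K) `^ `|t| * Llog x `^ t)); last by ring.
rewrite ler_wpM2l ?mulr_ge0 ?powR_ge0// powR_ratio ?Llog_gt0//; first lra.
  by rewrite mulrC [leRHS]mulrC LlogM.
rewrite (@le_trans _ _ (Llog (K * x)))//.
  by rewrite ler_Llog// ler_peMl.
by rewrite ler_peMl ?Llog_ge0//; lra.
Qed.

(** The logarithm of x^s (log x)^t is of the order of log x, since
    [powlog s t x] lies between constant multiples of x^(s/2) and x^(2s) for
    x >= 1. *)
Lemma Llog_powlog s t : 0 < s ->
  exists2 K, 1 <= K & forall x, 1 <= x ->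
    Llog x <= K * Llog (powlog s t x) /\ Llog (powlog s t x) <= K * Llog x.
Proof.
move=> s0; have s20 : 0 < s / 2 by rewrite divr_gt0.
have [K1 K10 K1P] := @powlog_incr (s / 2) t s20.
have [K2 K20 K2P] := @powlog_incr s (- t) s0.
have L1 : Llog (1 : R) = 1.
  by rewrite /Llog max_l ?expRK// -[leLHS](@expR0 R) ler_expR.
have p1 a b : powlog a b 1 = 1 by rewrite /powlog L1 !powR1 mulr1.
pose A := Num.max 1 K1; pose B := Num.max 1 K2.
have A1 : 1 <= A by rewrite le_max lexx.
have B1 : 1 <= B by rewrite le_max lexx.
pose CA := Num.max 1 (s / 2)^-1 * (1 + ln A).
pose CB := Num.max 1 (s * 2) * (1 + ln B).
have lA := ln_ge0 A1; have lB := ln_ge0 B1.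
have CA1 : 1 <= CA.
  by rewrite -[leLHS]mulr1 ler_pM// ?le_max ?lexx//; lra.
have CB1 : 1 <= CB.
  by rewrite -[leLHS]mulr1 ler_pM// ?le_max ?lexx//; lra.
exists (CA * CB); first by rewrite -[leLHS]mulr1 ler_pM.
move=> x x1; have x0 : 0 < x by lra.
have px := powlog_gt0 s t x0.
split.
  have H : x `^ (s / 2) <= A * powlog s t x.
    have := K1P 1 x ler01 x1; rewrite p1 => H.
    have -> : powlog s t x = x `^ (s / 2) * powlog (s / 2) t x.
      rewrite /powlog mulrA -powRD; first by congr (_ `^ _ * _); field.
      by rewrite (gt_eqF x0) implybT.
    rewrite mulrCA ler_peMr ?powR_ge0// (le_trans H)//.
    by rewrite ler_wpM2r ?powlog_ge0// /A le_max lexx orbT.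
  rewrite -{1}(@powRr1 _ x) ?(ltW x0)// -(@divff _ (s / 2)) ?gt_eqF// powRrM.
  rewrite (le_trans (Llog_powR _ _)) ?powR_gt0 ?invr_ge0 ?(ltW s20)//.
  rewrite mulrAC -[leLHS]mulr1 ler_pM ?mulr_ge0 ?Llog_ge0 ?le_max ?ler01//.
  rewrite -mulrA ler_wpM2l ?le_max ?ler01//.
  rewrite (le_trans (ler_Llog H))// mulrC (le_trans (LlogM _ A1)) ?(ltW px)//.
  by rewrite mulrC.
have H : powlog s t x <= x `^ (s * 2) * B.
  have := K2P 1 x ler01 x1; rewrite p1 => H.
  rewrite -[leLHS]mulr1 (le_trans (ler_wpM2l (ltW px) H))//.
  rewrite mulrCA powlogM// subrr /powlog powRr0 mulr1 mulrC -mulr2n.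
  rewrite mulr_natr ler_wpM2l ?powR_ge0// /B le_max lexx orbT//.
rewrite (le_trans (ler_Llog H))// (le_trans (LlogM _ B1)) ?powR_ge0//.
apply: (@le_trans _ _ (CB * Llog x)).
  rewrite /CB mulrAC ler_wpM2r ?Llog_powR//; first lra.
  by rewrite mulr_ge0// ltW.
by rewrite ler_pM2r ?Llog_gt0// ler_peMl//; lra.
Qed.

End slowly_varying.

(** * Geometric sums over a set of indices *)

Section dyadic_sums.
Context {R : realType}.
Implicit Types (x y z : R) (Q : pred nat) (q : nat -> R).

Lemma sum_pow2_le Q (M : R) N : 0 <= M ->
  (forall j, Q j -> 2 ^+ j <= M) -> \sum_(j < N | Q j) (2 : R) ^+ j <= 2 * M.
Proof.
move=> M0 QM; elim: N => [|N IH]; first by rewrite big_ord0 mulr_ge0.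
rewrite big_mkcond big_ord_recr/= -big_mkcond/=.
case: ifPn => [QN|_]; last by rewrite addr0.
rewrite [leRHS]mulr_natl mulr2n lerD//; last exact: QM.
apply: le_trans (QM _ QN).
apply: (@le_trans _ _ (\sum_(j < N) 2 ^+ j)).
  by rewrite big_mkcond/= ler_sum// => i _; case: ifP => // _; rewrite exprn_ge0.
have := subrX1 (2 : R) N; rewrite (_ : 2 - 1 = 1); last by ring.
by rewrite mul1r => <-; rewrite lerBlDr lerDl.
Qed.

(** A sequence decaying geometrically up to a constant, summed over any set of
    indices, is bounded by a constant times its supremum on this set: the first
    index of the set dominates all the later ones.  The induction peels off
    indices from the left until the first one lying in [Q]. *)
Lemma sum_geometric_le Q q (r K M : R) N : 0 < r < 1 -> 0 <= K -> 0 <= M ->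
  (forall j, 0 <= q j) ->
  (forall i j, (i <= j)%N -> q j <= K * r ^+ (j - i) * q i) ->
  (forall j, Q j -> q j <= M) -> \sum_(j < N | Q j) q j <= K * M / (1 - r).
Proof.
move=> /andP[r0 r1] K0 M0 q0 qr QM.
have b0 : 0 <= K * M / (1 - r) by rewrite mulr_ge0 ?mulr_ge0// invr_ge0; lra.
suff H k m : \sum_(j < k | Q (m + j)%N) q (m + j)%N <= K * M / (1 - r) by exact: (H N 0%N).
elim: k m => [|k IH] m; first by rewrite big_ord0.
have [Qm|nQm] := boolP (Q m); last first.
  rewrite big_mkcond big_ord_recl/= addn0 (negbTE nQm) add0r -big_mkcond/=.
  under eq_bigl do rewrite /bump leq0n addnA addn1.
  by under eq_bigr do rewrite /bump leq0n addnA addn1.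
apply: (@le_trans _ _ (\sum_(j < k.+1) K * r ^+ j * M)).
  rewrite big_mkcond/= ler_sum// => i _; case: ifP => // _; last first.
    by rewrite !mulr_ge0// exprn_ge0// ltW.
  rewrite (le_trans (qr m _ (leq_addr _ _)))// addKn.
  by rewrite ler_wpM2l ?QM// mulr_ge0// exprn_ge0// ltW.
rewrite -mulr_suml -mulr_sumr mulrAC ler_wpM2l ?mulr_ge0//.
have r10 : 0 < 1 - r by lra.
rewrite -[leRHS]mul1r ler_pdivlMr// mulrC.
have := subrX1 r k.+1 => /(congr1 -%R); rewrite -mulNr !opprB => <-.
by rewrite gerBl exprn_ge0// ltW.
Qed.

End dyadic_sums.

(** * The norming sequence and the moment function *)

Section norming.
Context {R : realType} (alpha b : R).
Hypothesis a1 : 1 < alpha.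
Hypothesis a2 : alpha < 2.
Implicit Types (x y z : R).

Let a0 : 0 < alpha. Proof. exact: lt_trans a1. Qed.
Let av0 : 0 < alpha^-1. Proof. by rewrite invr_gt0 a0. Qed.

Local Notation a := (powlog alpha^-1 b).
Local Notation g := (powlog alpha (- (b * alpha))).

(** Raising the norming function to the power alpha gives x (log x)^(b alpha),
    and the logarithmic factor of the moment function cancels against it up to
    a constant by [Llog_powlog]. *)
Lemma moment_norming : exists2 K, 0 < K & forall x, 1 <= x ->
  x <= K * g (a x) /\ g (a x) <= K * x.
Proof.
have [K K1 KP] := @Llog_powlog R alpha^-1 b av0.
exists (K `^ `|b * alpha|); first by rewrite powR_gt0//; lra.
move=> x x1; have [H1 H2] := KP _ x1; have x0 : 0 < x by lra.
have gE : g (a x) = x * (Llog x `^ (b * alpha) * Llog (a x) `^ (- (b * alpha))).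
  rewrite [LHS]/powlog powlogX mulVf ?(gt_eqF a0)// [X in X * _]/powlog powRr1 ?(ltW x0)//.
  by rewrite -mulrA.
rewrite gE !powRN; split.
  rewrite mulrCA ler_peMr ?(ltW x0)// mulrA ler_pdivlMr ?powR_gt0 ?Llog_gt0//.
  by rewrite mul1r powR_ratio ?Llog_gt0.
rewrite [leRHS]mulrC ler_wpM2l ?(ltW x0)// ler_pdivrMr ?powR_gt0 ?Llog_gt0//.
by rewrite powR_ratio ?Llog_gt0.
Qed.

Lemma moment_tail_ge : exists2 K, 0 < K & forall x z, 1 <= x -> a x <= z ->
  x <= K * g z.
Proof.
have [K K0 KP] := moment_norming.
have [K' K'0 K'P] := @powlog_incr R alpha (- (b * alpha)) a0.
exists (K * K'); first by rewrite mulr_gt0.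
move=> x z x1 xz; have [H _] := KP _ x1.
by rewrite (le_trans H)// -mulrA ler_pM2l// K'P// powlog_ge0.
Qed.

Lemma moment_tail_le C : 1 <= C -> exists2 K, 0 < K & forall x z, 1 <= x ->
  0 <= z -> z <= C * a x -> g z <= K * x.
Proof.
move=> C1; have [K K0 KP] := moment_norming.
have [K1 K10 K1P] := @powlog_incr R alpha (- (b * alpha)) a0.
have [K2 K20 K2P] := @powlog_scale R alpha (- (b * alpha)) C C1.
exists (K1 * (K2 * K)); first by rewrite !mulr_gt0.
move=> x z x1 z0 xz; have [_ H] := KP _ x1.
rewrite (le_trans (K1P _ _ z0 xz))// -mulrA ler_pM2l//.
by rewrite (le_trans (K2P _ (powlog_ge0 _ _ _)))// -mulrA ler_pM2l.
Qed.

(** Controls the mean lost by truncation; it needs alpha > 1 for g(z) / z to be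
    increasing up to a constant. *)
Lemma moment_first : exists2 K, 0 < K & forall x z, 1 <= x -> a x <= z ->
  x * z <= K * a x * g z.
Proof.
have [K K0 KP] := moment_norming.
have am1 : 0 < alpha - 1 by rewrite subr_gt0 a1.
have [K' K'0 K'P] := @powlog_incr R (alpha - 1) (- (b * alpha)) am1.
exists (K * K'); first by rewrite mulr_gt0.
move=> x z x1 xz; have [H _] := KP _ x1; have x0 : 0 < x by lra.
have ax := powlog_gt0 alpha^-1 b x0; have z0 : 0 < z by apply: lt_le_trans xz.
have gE y : 0 < y -> g y = y * powlog (alpha - 1) (- (b * alpha)) y.
  by move=> y0; rewrite /powlog mulrA mulr_powRB1// ltW.
rewrite (gE z)//; rewrite (gE _ ax) in H.
rewrite [leRHS](_ : _ = z * (K * (a x *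
    (K' * powlog (alpha - 1) (- (b * alpha)) z)))); last by ring.
rewrite mulrC ler_pM2l// (le_trans H)// ler_pM2l// ler_pM2l//.
exact: K'P (ltW _) _.
Qed.

(** Controls the truncated second moment; it needs alpha < 2 for g(z) / z^2 to
    be decreasing up to a constant. *)
Lemma moment_second : exists2 K, 0 < K & forall x z, 1 <= x -> 0 < z ->
  z <= a x -> x / a x ^+ 2 <= K * (g z / z ^+ 2).
Proof.
have [K K0 KP] := moment_norming.
have am1 : alpha - 2 < 0 by rewrite subr_lt0 a2.
have [K' K'0 K'P] := @powlog_decr R (alpha - 2) (- (b * alpha)) am1.
exists (K * K'); first by rewrite mulr_gt0.
move=> x z x1 z0 xz; have [H _] := KP _ x1; have x0 : 0 < x by lra.
have ax := powlog_gt0 alpha^-1 b x0.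
have gE y : 0 < y -> g y / y ^+ 2 = powlog (alpha - 2) (- (b * alpha)) y.
  move=> y0; rewrite -(@powR_mulrn _ y 2) ?(ltW y0)// -powRN /powlog mulrAC -powRD//.
  by rewrite (gt_eqF y0) implybT.
rewrite gE// -mulrA.
apply: (@le_trans _ _ (K * (g (a x) / a x ^+ 2))).
  by rewrite mulrA ler_pM2r// invr_gt0 exprn_gt0.
by rewrite gE// ler_pM2l// K'P.
Qed.

(** The exponent 1 - 2/alpha of x / a(x)^2 is negative; half of it is spent on
    absorbing the logarithm and the other half gives the ratio. *)
Lemma norming_geometric : exists r K, [/\ 0 < r < 1, 0 < K &
  forall i j, (i <= j)%N -> 2 ^+ j / a (2 ^+ j) ^+ 2 <=
     K * r ^+ (j - i) * (2 ^+ i / a (2 ^+ i) ^+ 2)].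
Proof.
pose e := (1 - 2 / alpha) / 2.
have e0 : e < 0.
  by rewrite /e pmulr_llt0 ?invr_gt0// subr_lt0 ltr_pdivlMr ?a0// mul1r a2.
have [K K0 KP] := @powlog_decr R e (- (b * 2)) e0.
exists (2 `^ e), K; split => //.
  rewrite powR_gt0//= /powR gt_eqF// -[ltRHS](@expR0 R) ltr_expR pmulr_llt0//.
  by rewrite ln_gt0// ltr1n.
have qE x : 0 < x -> x / a x ^+ 2 = x `^ e * powlog e (- (b * 2)) x.
  move=> x0; have ax := powlog_gt0 alpha^-1 b x0.
  have xs s s' : x `^ s * x `^ s' = x `^ (s + s').
    by rewrite powRD// (gt_eqF x0) implybT.
  rewrite -(@powR_mulrn _ (a x) 2) ?(ltW ax)// -powRN powlogX /powlog.
  rewrite -{1}(@powRr1 _ x) ?(ltW x0)// !mulrA !xs !mulrN.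
  by congr (_ `^ _ * _); rewrite /e; field; rewrite (gt_eqF a0).
move=> i j ij; have p n : 0 < (2 : R) ^+ n by rewrite exprn_gt0.
rewrite !qE// {1}(_ : 2 ^+ j = 2 ^+ (j - i) * 2 ^+ i); last by rewrite -exprD subnK.
rewrite powRM ?(ltW (p _))//.
rewrite [X in X * _ * _](_ : _ = 2 `^ e ^+ (j - i)); last first.
  by rewrite -(@powR_mulrn _ 2 (j - i))// powRAC powR_mulrn ?powR_ge0.
rewrite [leRHS](_ : _ = 2 `^ e ^+ (j - i) * (2 ^+ i) `^ e *
    (K * powlog e (- (b * 2)) (2 ^+ i))); last by ring.
rewrite ler_wpM2l ?mulr_ge0 ?exprn_ge0 ?powR_ge0//.
by rewrite KP// ler_eXn2l// ltr1n.
Qed.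

Lemma dyadic_tail_sum : exists2 K, 0 < K & forall N z, 0 <= z ->
  \sum_(j < N) 2 ^+ j * (a (2 ^+ j) < z)%R%:R <= K * g z.
Proof.
have [K K0 KP] := moment_tail_ge.
exists (2 * K); first by rewrite mulr_gt0.
move=> N z z0; rewrite -mulrA.
under eq_bigr do rewrite mulr_natr mulrb.
rewrite -big_mkcond/= (@sum_pow2_le _ [pred j | a (2 ^+ j) < z])//.
  by rewrite mulr_ge0 ?powlog_ge0// ltW.
by move=> j /= /ltW az; apply: KP => //; rewrite exprn_ege1// ler1n.
Qed.

Lemma dyadic_second_moment_sum : exists2 K, 0 < K & forall N z, 0 <= z ->
  \sum_(j < N) 2 ^+ j / a (2 ^+ j) ^+ 2 * (z ^+ 2 * (z <= a (2 ^+ j))%R%:R)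
    <= K * g z.
Proof.
have [K K0 KP] := moment_second.
have [r [L [/andP[r0 r1] L0 LP]]] := norming_geometric.
have r10 : 0 < 1 - r by lra.
exists (L * K / (1 - r)); first by rewrite !mulr_gt0// invr_gt0.
move=> N z; rewrite le_eqVlt => /predU1P[<-|z0].
  rewrite big1 => [|i _]; last by rewrite expr0n/= mul0r mulr0.
  by rewrite powlog0 ?mulr0// gt_eqF.
have z20 : 0 < z ^+ 2 by rewrite exprn_gt0.
under eq_bigr do rewrite mulrA mulrAC mulr_natr mulrb.
rewrite -mulr_suml -ler_pdivlMr// -big_mkcond/=.
rewrite [leRHS](_ : _ = L * (K * (g z / z ^+ 2)) / (1 - r)); last by ring.
apply: (@sum_geometric_le _ [pred j | z <= a (2 ^+ j)]
  (fun j => 2 ^+ j / a (2 ^+ j) ^+ 2)) => //.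
- by rewrite r0.
- exact: ltW.
- by rewrite mulr_ge0 ?(ltW K0)// divr_ge0 ?powlog_ge0// ltW.
- by move=> j; rewrite divr_ge0 ?exprn_ge0 ?powlog_ge0.
by move=> j /= zj; apply: KP => //; rewrite exprn_ege1// ler1n.
Qed.

Lemma norming_dyadic : exists2 K, 0 < K & forall x y, 1 <= x -> 0 <= y ->
  y <= 2 * x -> a y <= K * a x.
Proof.
have [K1 K10 K1P] := @powlog_incr R alpha^-1 b av0.
have [|K2 K20 K2P] := @powlog_scale R alpha^-1 b 2; first by rewrite ler1n.
exists (K1 * K2); first by rewrite mulr_gt0.
move=> x y x1 y0 yx; rewrite (le_trans (K1P _ _ y0 yx))// -mulrA ler_pM2l//.
by apply: K2P; lra.
Qed.

End norming.

(** * Independence of blocks of variables *)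

Section independence.
Context d (T : measurableType d) (R : realType) (P : probability T R).

(** The events A with P(A & C) = P(A) P(C) form a Dynkin system, so independence
    from [C] extends from a pi-system to the sigma-algebra it generates. *)
Lemma independent_generated (G : set (set T)) (C : set T) :
  setI_closed G -> G `<=` measurable -> measurable C ->
  (forall A, G A -> P (A `&` C) = (P A * P C)%E) ->
  forall A, <<s G >> A -> P (A `&` C) = (P A * P C)%E.
Proof.
move=> GI Gm mC GC.
have sGm : <<s G >> `<=` @measurable _ T.
  by apply: smallest_sub => //; exact: sigma_algebra_measurable.
suff H : <<s G >> `<=` [set A | measurable A /\ P (A `&` C) = (P A * P C)%E].
  by move=> A /H[].
apply: lambda_system_subset => //; last by move=> A GA; split; [exact: Gm|exact: GC].
apply/dynkin_lambda_system; split.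
- by split => //; rewrite setTI probability_setT mul1e.
- move=> A [mA AC]; split; first exact: measurableC.
  rewrite setIC -setDE measureD//; last by rewrite ltey_eq fin_num_measure.
  rewrite (setIC C A) -[X in (_ - X)%E]/(P (A `&` C)) AC probability_setC//.
  by rewrite muleBl ?mul1e ?fin_num_measure.
- move=> F tF FC; split; first by apply: bigcupT_measurable => n; case: (FC n).
  rewrite setI_bigcupl measure_bigcup//; last 2 first.
    by move=> n _; apply: measurableI => //; case: (FC n).
    exact: trivIset_setIr.
  rewrite measure_bigcup//; last by move=> n _; case: (FC n).
  rewrite muleC -(fineK (fin_num_measure P _ mC)) -nneseriesZl//.
  apply: eq_eseriesr => n _; rewrite fineK ?fin_num_measure// muleC.
  by case: (FC n).
Qed.

Variable X : nat -> {RV P >-> R}.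

(** The pi-system of rectangles on the coordinates in [I]; it generates the
    sigma-algebra of the variables X i with i in [I]. *)
Definition cylinders (I : set nat) : set (set T) :=
  [set A | exists (J : {fset nat}) (B : nat -> set R),
    [/\ [set` J] `<=` I, forall i, measurable (B i) &
        A = \bigcap_(i in [set` J]) (X i @^-1` B i)]].

Lemma cylinder_measurable I : cylinders I `<=` measurable.
Proof.
move=> _ [J [B [_ mB ->]]]; rewrite bigcap_fset.
apply: bigsetI_measurable => i _.
by rewrite -[X in measurable X]setTI; apply: measurable_funP.
Qed.

Lemma cylinder_setI I : setI_closed (cylinders I).
Proof.
move=> _ _ [J1 [B1 [JI1 mB1 ->]]] [J2 [B2 [JI2 mB2 ->]]].
pose r (J : {fset nat}) (B : nat -> set R) i := if i \in J then B i else setT.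
exists (J1 `|` J2)%fset, (fun i => r J1 B1 i `&` r J2 B2 i); split.
- move=> i /=; rewrite in_fsetU => /orP[]; [exact: JI1|exact: JI2].
- by move=> i; apply: measurableI; rewrite /r; case: ifP.
apply/seteqP; split => w /=.
  by move=> [h1 h2] i /= _; rewrite /r; split; case: ifP => // iJ; [exact: h1|exact: h2].
move=> h; split => i /= iJ.
  have iU : i \in (J1 `|` J2)%fset by rewrite in_fsetU iJ.
  by have [+ _] := h i iU; rewrite /r iJ.
have iU : i \in (J1 `|` J2)%fset by rewrite in_fsetU iJ orbT.
by have [_] := h i iU; rewrite /r iJ.
Qed.

Hypothesis indX : mutually_independent X.

Lemma independent_cylinders I1 I2 A1 A2 : I1 `&` I2 = set0 ->
  cylinders I1 A1 -> cylinders I2 A2 -> P (A1 `&` A2) = (P A1 * P A2)%E.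
Proof.
move=> I12 [J1 [B1 [JI1 mB1 ->]]] [J2 [B2 [JI2 mB2 ->]]].
have dis i : i \in J1 -> i \in J2 -> False.
  by move=> /JI1 i1 /JI2 i2; rewrite -[False]/(set0 i) -I12.
pose B i := if i \in J1 then B1 i else B2 i.
have -> : (\bigcap_(i in [set` J1]) X i @^-1` B1 i) `&`
          (\bigcap_(i in [set` J2]) X i @^-1` B2 i) =
          \bigcap_(i in [set` (J1 `|` J2)%fset]) (X i @^-1` B i).
  apply/seteqP; split => w /=.
    move=> [h1 h2] i /=; rewrite in_fsetU /B; case: ifPn => [i1 _|_ /= i2].
      exact: h1.
    exact: h2.
  move=> h; split => i /= iJ.
    by have := h i; rewrite /= in_fsetU iJ /B iJ; exact.
  have := h i; rewrite /= in_fsetU iJ orbT /B; case: ifPn => [i1|_]; last exact.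
  by have := dis _ i1 iJ.
rewrite !indX//; last first.
  by move=> i _; rewrite /B; case: ifP.
have pJ : perm_eq (J1 `|` J2)%fset (J1 ++ J2).
  apply: uniq_perm; first exact: fset_uniq.
    rewrite cat_uniq !fset_uniq andbT/=; apply/hasPn => i i2.
    by apply/negP => i1; exact: dis i1 i2.
  by move=> i; rewrite in_fsetU mem_cat.
rewrite (perm_big _ pJ) big_cat/=; congr (_ * _)%E.
  by apply: eq_big_seq => i i1; rewrite /B i1.
apply: eq_big_seq => i i2; rewrite /B; case: ifPn => // i1.
by have := dis _ i1 i2.
Qed.

(** [independent_generated] is applied twice, once for each block: first with a
    fixed event of the second sigma-algebra, then with a fixed cylinder. *)
Lemma independent_blocks I1 I2 A1 A2 : I1 `&` I2 = set0 ->
  <<s cylinders I1 >> A1 -> <<s cylinders I2 >> A2 ->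
  P (A1 `&` A2) = (P A1 * P A2)%E.
Proof.
move=> I12 sA1 sA2.
have ms I A : <<s cylinders I >> A -> measurable A.
  apply: smallest_sub A; first exact: sigma_algebra_measurable.
  exact: cylinder_measurable.
apply: (independent_generated (@cylinder_setI I1) (@cylinder_measurable I1)
  (ms _ _ sA2)) sA1.
move=> B1 cB1; rewrite setIC muleC.
apply: (independent_generated (@cylinder_setI I2) (@cylinder_measurable I2) _ _) sA2.
  exact: cylinder_measurable cB1.
by move=> B2 cB2; rewrite setIC muleC; exact: independent_cylinders cB1 cB2.
Qed.

Lemma measurable_coordinate (I : set nat) i : I i ->
  measurable_fun setT (X i : g_sigma_algebraType (cylinders I) -> R).
Proof.
move=> Ii _ B mB; rewrite setTI; apply: sub_sigma_algebra.
exists [fset i]%fset, (fun=> B); split => //.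
  by move=> j /=; rewrite inE => /eqP ->.
by rewrite set_fset1 bigcap_set1.
Qed.

Lemma measurable_block_sum (f : R -> R) (I : set nat) m n :
  measurable_fun setT f -> (forall i, (m <= i < n)%N -> I i) ->
  measurable_fun setT
    ((fun w => \sum_(m <= i < n) f (X i w)) : g_sigma_algebraType (cylinders I) -> R).
Proof.
move=> mf mnI; rewrite (_ : (fun _ => _) = (fun w =>
    \sum_(i <- index_iota m n)
      if (m <= i < n)%N then f (X i w) else 0)); last first.
  apply/funext => w; rewrite big_seq [RHS]big_seq; apply: eq_bigr => i.
  by rewrite mem_index_iota => ->.
apply: measurable_sum => i; case E : (m <= i < n)%N => //.
have Ii := mnI _ E.
exact: measurableT_comp (measurable_coordinate Ii).
Qed.

End independence.

(** * A maximal inequality *)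

Section bounded_functions.
Context d (T : measurableType d) (R : realType) (P : probability T R).

Lemma bounded_Lfun2 (f : T -> R) (M : R) : measurable_fun setT f ->
  (forall w, `|f w| <= M) -> f \in Lfun P 2%:E.
Proof.
move=> mf fM; rewrite inE/=; apply/andP; split; rewrite inE//=.
rewrite /finite_norm unlock poweR_lty//.
apply/integrable_lty => //.
have iM := @finite_measure_integrable_cst _ _ _ P setT (M `^ 2) measurableT.
apply: (le_integrable _ _ _ iM) => //.
  apply/measurable_EFinP; apply: (measurableT_comp (measurable_powR _)).
  exact: measurableT_comp.
move=> w _ /=; rewrite lee_fin (@ger0_norm _ (`|f w| `^ 2)) ?powR_ge0//.
rewrite [leRHS]ger0_norm ?powR_ge0//.
by apply: ge0_ler_powR; rewrite ?nnegrE ?(le_trans _ (fM w)).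
Qed.

Lemma Lfun21 (f : T -> R) : f \in Lfun P 2%:E -> f \in Lfun P 1.
Proof. by apply: Lfun_subset12; rewrite fin_num_measure. Qed.

End bounded_functions.

Lemma measurable_norm_ge d (T : measurableType d) (R : realType) (f : T -> R)
    (c : R) : measurable_fun setT f -> measurable [set w | c <= `|f w|].
Proof.
move=> mf; rewrite -[X in measurable X]setTI.
rewrite (_ : [set w | _] = (fun w => `|f w|) @^-1` `[c, +oo[); last first.
  by apply/seteqP; split => w /=; rewrite in_itv/= andbT.
by apply: measurableT_comp.
Qed.

Lemma measurable_norm_lt d (T : measurableType d) (R : realType) (f : T -> R)
    (c : R) : measurable_fun setT f -> measurable [set w | `|f w| < c].
Proof.
move=> mf; rewrite (_ : [set w | _] = ~` [set w | c <= `|f w|]).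
  exact/measurableC/measurable_norm_ge.
by apply/seteqP; split => w /=; rewrite ltNge => /negP.
Qed.

Lemma measurable_norm_gt d (T : measurableType d) (R : realType) (f : T -> R)
    (c : R) : measurable_fun setT f -> measurable [set w | c < `|f w|].
Proof.
move=> mf; rewrite -[X in measurable X]setTI.
rewrite (_ : [set w | _] = (fun w => `|f w|) @^-1` `]c, +oo[); last first.
  by apply/seteqP; split => w /=; rewrite in_itv/= andbT.
by apply: measurableT_comp.
Qed.

Section ottaviani.
Context d (T : measurableType d) (R : realType) (P : probability T R).
Local Open Scope ereal_scope.

(** Ottaviani's inequality, for an abstract process.  By induction on [k], half
    of the probability that |S| has reached 2 l before time k is carried by
    paths with |S n| >= l: at each first passage the increment up to time n is
    independent of the past and stays below l with probability at least one
    half.  Working with the increasing events [M k] avoids the decomposition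
    into first passage times. *)
Lemma ottaviani (S : nat -> T -> R) (n : nat) (l : R)
    (M := fun k => \big[setU/set0]_(i < k) [set w | (2 * l <= `|S i w|)%R])
    (D := fun k => [set w | (`|S n w - S k w| < l)%R]) :
  (forall k, measurable_fun setT (S k)) ->
  (forall k, (k <= n)%N ->
    P (([set w | (2 * l <= `|S k w|)%R] `\` M k) `&` D k) =
    P ([set w | (2 * l <= `|S k w|)%R] `\` M k) * P (D k)) ->
  (forall k, (k <= n)%N -> (2^-1)%:E <= P (D k)) ->
  (2^-1)%:E * P (M n.+1) <= P [set w | (l <= `|S n w|)%R].
Proof.
move=> mS indep half.
have mE k (c : R) : measurable [set w | (c <= `|S k w|)%R].
  exact: measurable_norm_ge.
have mD k : measurable (D k).
  by apply: measurable_norm_lt; exact: measurable_funB.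
have mM k : measurable (M k) by apply: bigsetU_measurable.
have MS k : M k.+1 = M k `|` ([set w | (2 * l <= `|S k w|)%R] `\` M k).
  by rewrite {1}/M big_ord_recr/= -/(M k) setUDr setDv setD0.
set H := [set w | _].
have mH : measurable H by exact: mE.
suff : forall k, (k <= n.+1)%N -> (2^-1)%:E * P (M k) <= P (M k `&` H).
  move=> /(_ _ (leqnn _))/le_trans; apply.
  by rewrite le_measure ?inE//; apply: measurableI.
elim => [_|k IH kn]; first by rewrite /M big_ord0 set0I measure0 mule0.
have mA : measurable ([set w | (2 * l <= `|S k w|)%R] `\` M k) by apply: measurableD.
rewrite MS setIUl !measureU//; last 4 first.
- exact: measurableI.
- exact: measurableI.
- by rewrite setIACA setDIK set0I.
- by rewrite setDIK.
rewrite ge0_muleDr ?measure_ge0// leeD ?IH 1?ltnW//.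
apply: (@le_trans _ _ (P (([set w | (2 * l <= `|S k w|)%R] `\` M k) `&` D k))).
  by rewrite indep// muleC lee_wpmul2l ?half.
have mAD : measurable (([set w | (2 * l <= `|S k w|)%R] `\` M k) `&` D k).
  by apply: measurableI.
have mAH : measurable (([set w | (2 * l <= `|S k w|)%R] `\` M k) `&` H).
  by apply: measurableI.
apply: le_measure; rewrite ?inE//.
move=> w [[lk Mk] Dk]; split => //.
move: lk Dk; rewrite /H /D /= => lk Dk.
have := ler_normB (S n w) (S n w - S k w)%R; rewrite subKr => h.
by lra.
Qed.

End ottaviani.

Section truncated_sums.
Context d (T : measurableType d) (R : realType) (P : probability T R).
Variable X : nat -> {RV P >-> R}.
Hypothesis iidX : iid X.
Variables (f : R -> R) (M : R).
Hypothesis mf : measurable_fun setT f.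
Hypothesis fM : forall x, `|f x| <= M.
Local Open Scope ereal_scope.

Let Y i w := f (X i w).
Let S m n w := (\sum_(m <= i < n) f (X i w))%R.

Let mY i : measurable_fun setT (Y i).
Proof. exact: measurableT_comp. Qed.

Let mS m n : measurable_fun setT (S m n).
Proof. by apply: measurable_sum => i; exact: mY. Qed.

Let Y2 i : Y i \in Lfun P 2%:E.
Proof. by apply: bounded_Lfun2 (mY i) _ => w; exact: fM. Qed.

Let SS m k : S m (m + k.+1)%N = (S m (m + k)%N \+ Y (m + k)%N)%R.
Proof. by apply/funext => w; rewrite /S addnS big_nat_recr ?leq_addr. Qed.

Let S0 m : S m (m + 0)%N = cst 0%R.
Proof. by apply/funext => w; rewrite /S addn0 big_geq. Qed.

Let S2 m k : S m (m + k)%N \in Lfun P 2%:E.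
Proof.
elim: k => [|k IH]; first by rewrite S0 Lfun_cst.
rewrite SS; apply: (@bounded_Lfun2 _ _ _ _ _ (k.+1%:R * M)%R) => [|w].
  by rewrite -SS; exact: mS.
rewrite -SS /S (le_trans (ler_norm_sum _ _ _))//.
rewrite (le_trans (ler_sum _ (fun i _ => fM _)))//.
by rewrite sumr_const_nat addKn mulr_natl.
Qed.

Lemma expectation_ident (h : R -> R) i : measurable_fun setT h ->
  (forall x, (0 <= h x)%R) \/ (h \o X i \in Lfun P 1 /\ h \o X 0%N \in Lfun P 1) ->
  'E_P[h \o X i] = 'E_P[h \o X 0%N].
Proof.
move=> mh H; rewrite unlock.
have mEh : measurable_fun setT (EFin \o h) by apply/measurable_EFinP.
have E : \int[distribution P (X i)]_y (EFin \o h) y =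
    \int[distribution P (X 0%N)]_y (EFin \o h) y.
  by apply: eq_measure_integral => A mA _; exact: iidX.2.
case: H => [h0|[/Lfun1_integrable i1 /Lfun1_integrable i2]].
  by rewrite !ge0_integral_distribution in E.
by rewrite !integral_distribution in E.
Qed.

Let EY i : 'E_P[Y i] = 'E_P[Y 0%N].
Proof. by apply: expectation_ident => //; right; split; apply/Lfun21/Y2. Qed.

Let ES m k : 'E_P[S m (m + k)%N] = k%:R%:E * 'E_P[Y 0%N].
Proof.
elim: k => [|k IH]; first by rewrite S0 expectation_cst mul0e.
rewrite SS expectationD ?Lfun21 ?S2 ?Y2// IH EY.
rewrite -(fineK (expectation_fin_num (Lfun21 (Y2 0)))) -!EFinM -EFinD.
by rewrite -natr1 mulrDl mul1r.
Qed.

(** The joint law of two variables agrees with the product of their laws on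
    rectangles, hence everywhere; Fubini's theorem then splits the integral. *)
Lemma expectation_mul_independent i j : i != j ->
  'E_P[Y i * Y j]%R = 'E_P[Y i] * 'E_P[Y j].
Proof.
move=> ij.
pose Z w := (X i w, X j w).
have mZ : measurable_fun setT Z by exact: measurable_fun_pair.
pose ZRV : {mfun T >-> (R * R)%type} := mfun_Sub (mem_set mZ).
pose mu := distribution P (X i); pose nu := distribution P (X j).
have E A : measurable A -> (mu \x nu) A = distribution P ZRV A.
  apply: product_measure_unique => B C mB mC.
  have [ind _] := iidX.
  have := ind [fset i; j]%fset (fun k => if k == i then B else C).
  rewrite big_fsetU1 ?inE// big_seq_fset1 eqxx eq_sym (negbTE ij) => <-; last first.
    by move=> k _; case: ifP.
  rewrite /distribution /pushforward; congr (P _).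
  apply/seteqP; split => w /=.
    move=> [wB wC] k /=; rewrite !inE => /orP[]/eqP ->; first by rewrite eqxx.
    by rewrite eq_sym (negbTE ij).
  move=> h; split.
    by have := h i; rewrite /= !inE eqxx; exact.
  by have := h j; rewrite /= !inE eqxx orbT eq_sym (negbTE ij); exact.
pose F (z : R * R) := (f z.1 * f z.2)%:E.
have mF : measurable_fun setT F.
  apply/measurable_EFinP; apply: measurable_funM.
    exact: measurableT_comp measurable_fst.
  exact: measurableT_comp measurable_snd.
have iF : (mu \x nu).-integrable setT F.
  apply: measurable_bounded_integrable => //.
  - have : ((mu \x nu) setT < +oo).
      by rewrite E// /distribution /pushforward preimage_setT probability_setT ltry.
    exact.
  - exact/measurable_EFinP.
  exists (M * M)%R; split; first exact: num_real.
  by move=> c Mc z _ /=; rewrite (le_trans _ (ltW Mc))//= normrM ler_pM.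
have M1 k : P.-integrable setT (EFin \o Y k).
  by apply/Lfun1_integrable/Lfun21/Y2.
have D1 k : (distribution P (X k)).-integrable setT (EFin \o f).
  apply: measurable_bounded_integrable => //.
  - have : distribution P (X k) setT < +oo.
      by rewrite /distribution /pushforward preimage_setT probability_setT ltry.
    exact.
  exists M; split; first exact: num_real.
  by move=> c Mc z _ /=; rewrite (le_trans _ (ltW Mc)).
have DE k : \int[distribution P (X k)]_x (f x)%:E = 'E_P[Y k].
  rewrite unlock (@integral_distribution _ _ _ _ _ P (X k) (EFin \o f))//.
    exact/measurable_EFinP.
  exact: M1.
have -> : 'E_P[Y i * Y j]%R = \int[distribution P ZRV]_z F z.
  rewrite unlock integral_distribution//.
  have /Lfun1_integrable := Lfun2_mul_Lfun1 (Y2 i) (Y2 j); exact.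
rewrite (eq_measure_integral (mu \x nu)); last by move=> A mA _; apply/esym/E.
rewrite -integral12_prod_meas1// -!DE.
rewrite (eq_integral (fun x => (f x)%:E * 'E_P[Y j])); last first.
  move=> x _ /=; rewrite /fubini_F /F/=; under eq_integral do rewrite EFinM.
  by rewrite integralZl//; [rewrite -(DE j)|exact: D1].
rewrite [X in _ = _ * X]DE -(fineK (expectation_fin_num (Lfun21 (Y2 j)))).
by rewrite integralZr//; exact: D1.
Qed.

Let cov0 i j : i != j -> covariance P (Y i) (Y j) = 0.
Proof.
have YY : (Y i * Y j)%R \in Lfun P 1 by apply: (Lfun2_mul_Lfun1 (Y2 i) (Y2 j)).
move=> ij; rewrite covarianceE ?YY ?(Lfun21 (Y2 _))//.
rewrite expectation_mul_independent// subee// fin_numM//.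
  exact: expectation_fin_num (Lfun21 (Y2 i)).
exact: expectation_fin_num (Lfun21 (Y2 j)).
Qed.

Let covS m k j : (m + k <= j)%N -> covariance P (S m (m + k)%N) (Y j) = 0.
Proof.
elim: k => [|k IH] mkj; first by rewrite S0 covariance_cst_l.
rewrite SS covarianceDl ?S2 ?Y2// IH ?cov0 ?adde0//.
  by rewrite ltn_eqF// -addnS.
by rewrite (leq_trans _ mkj)// leq_add2l.
Qed.

Let VY i : 'V_P[Y i] = 'V_P[Y 0%N].
Proof.
rewrite !varianceE ?Y2// EY; congr (_ - _).
apply: (@expectation_ident (fun x => f x ^+ 2)%R).
  exact: measurable_funX.
by left => x; exact: sqr_ge0.
Qed.

Let VS m k : 'V_P[S m (m + k)%N] = k%:R%:E * 'V_P[Y 0%N].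
Proof.
elim: k => [|k IH]; first by rewrite S0 variance_cst mul0e.
rewrite SS varianceD ?S2 ?Y2// IH VY covS// mule0 adde0.
rewrite -(fineK (variance_fin_num (Y2 0))) -!EFinM -EFinD.
by rewrite -natr1 mulrDl mul1r.
Qed.

Lemma variance_le_second_moment :
  'V_P[Y 0%N] <= 'E_P[fun w => (f (X 0%N w) ^+ 2)%R].
Proof.
rewrite varianceE ?Y2// -[leRHS]sube0 leeB//.
have := expectation_fin_num (Lfun21 (Y2 0)); case: ('E_P[_]) => // r _.
by rewrite expe2 -EFinM lee_fin -expr2 sqr_ge0.
Qed.

Let mu := fine 'E_P[Y 0%N].

Lemma chebyshev_block m n N (l : R) : (0 < l)%R -> (m <= n)%N -> (n - m <= N)%N ->
  P [set w | (l <= `|S m n w - (n - m)%:R * mu|)%R] <=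
  (l ^- 2 * N%:R)%:E * 'V_P[Y 0%N].
Proof.
move=> l0 mn nmN; pose Z : {RV P >-> R} := mfun_Sub (mem_set (mS m n)).
have := chebyshev Z l0.
have nE : n = (m + (n - m))%N by rewrite subnKC.
have -> : fine 'E_P[Z] = ((n - m)%:R * mu)%R.
  by rewrite /= nE ES -nE fineM ?expectation_fin_num ?Lfun21 ?Y2.
move=> /le_trans; apply.
have := VS m (n - m); rewrite subnKC// => VZ.
rewrite [X in _ * X](_ : _ = 'V_P[S m n])// VZ.
rewrite EFinM -muleA lee_wpmul2l//; first by rewrite lee_fin invr_ge0 exprn_ge0// ltW.
by rewrite lee_wpmul2r ?variance_ge0// lee_fin ler_nat.
Qed.

(** If the right-hand side is at least 1 there is nothing to prove; otherwise
    Chebyshev's inequality bounds the probability of a large increment over any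
    block by one half, and Ottaviani's inequality applies.  Its hypothesis only
    involves events, so that [independent_blocks] suffices. *)
Lemma maximal_inequality n (l : R) : (0 < l)%R ->
  P (\big[setU/set0]_(k < n.+1)
       [set w | (2 * l <= `|S 1 k.+1 w - k%:R * mu|)%R]) <=
  (2 * (l ^- 2 * n%:R))%:E * 'E_P[fun w => (f (X 0%N w) ^+ 2)%R].
Proof.
move=> l0.
have V2 := variance_le_second_moment.
set c := (l ^- 2 * n%:R)%R.
have c0 : (0 <= c)%R by rewrite mulr_ge0// invr_ge0 exprn_ge0// ltW.
apply: (@le_trans _ _ ((2 * c)%:E * 'V_P[Y 0%N])); last first.
  by rewrite lee_wpmul2l// lee_fin mulr_ge0.
pose W k w := (S 1 k.+1 w - k%:R * mu)%R.
have mW k : measurable_fun setT (W k) by apply: measurable_funB => //; exact: mS.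
have mM : measurable (\big[setU/set0]_(k < n.+1) [set w | (2 * l <= `|W k w|)%R]).
  by apply: bigsetU_measurable => k _; exact: measurable_norm_ge.
have [big|small] := leP 1 ((2 * c)%:E * 'V_P[Y 0%N]).
  by rewrite (le_trans _ big)// probability_le1.
have WE k w : (k <= n)%N -> (W n w - W k w = S k.+1 n.+1 w - (n.+1 - k.+1)%:R * mu)%R.
  move=> kn; rewrite /W /S (@big_cat_nat _ _ _ k.+1 1 n.+1)//=.
  by rewrite subSS natrB//; ring.
have Dk k : (k <= n)%N -> (2^-1)%:E <= P [set w | (`|W n w - W k w| < l)%R].
  move=> kn.
  have mC : measurable [set w | (l <= `|W n w - W k w|)%R].
    by apply: measurable_norm_ge; exact: measurable_funB.
  have -> : [set w | (`|W n w - W k w| < l)%R] =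
      ~` [set w | (l <= `|W n w - W k w|)%R].
    by apply/seteqP; split => w /=; rewrite ltNge => /negP.
  rewrite probability_setC// leeBrDr ?fin_num_measure//.
  have : P [set w | (l <= `|W n w - W k w|)%R] <= (2^-1)%:E.
    under eq_set do rewrite WE//.
    have knn : (n.+1 - k.+1 <= n)%N by rewrite subSS leq_subr.
    apply: le_trans (@chebyshev_block k.+1 n.+1 n l l0 kn knn) _.
    have := small; rewrite -(fineK (variance_fin_num (Y2 0))) -!EFinM lte_fin lee_fin.
    by rewrite -/c; lra.
  move=> h; rewrite (le_trans (leeD2l _ h))// -EFinD lee_fin.
  by lra.
have -> : (2 * c)%:E * 'V_P[Y 0%N] = 2%:E * (c%:E * 'V_P[Y 0%N]).
  by rewrite muleA -EFinM.
rewrite -lee_pdivrMl//.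
apply: (@le_trans _ _ (P [set w | (l <= `|W n w|)%R])); last first.
  rewrite /W; have n1 : (n.+1 - 1 <= n)%N by rewrite subn1.
  by have := @chebyshev_block 1 n.+1 n l l0 isT n1; rewrite subn1.
apply: ottaviani => //= k kn.
pose I1 := [set i | (1 <= i < k.+1)%N]; pose I2 := [set i | (k.+1 <= i < n.+1)%N].
apply: (independent_blocks iidX.1 (I1 := I1) (I2 := I2)).
- by apply/seteqP; split => // i [] /= /andP[_ ik] /andP[]; rewrite leqNgt ik.
- pose past : measurableType _ := g_sigma_algebraType (cylinders X I1).
  have mI i : (i <= k)%N -> measurable_fun setT (W i : past -> R).
    move=> ik; apply: measurable_funB => //.
    apply: measurable_block_sum => // j /andP[j1 ji]; apply/andP; split => //.
    exact: leq_trans ji _.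
  have : measurable ([set w | (2 * l <= `|W k w|)%R] `\`
      \big[setU/set0]_(i < k) [set w | (2 * l <= `|W i w|)%R] : set past).
    apply: measurableD.
      exact: (@measurable_norm_ge _ past _ _ _ (mI k (leqnn k))).
    apply: bigsetU_measurable => i _.
    exact: (@measurable_norm_ge _ past _ _ _ (mI i (ltnW (ltn_ord i)))).
  exact.
- pose future : measurableType _ := g_sigma_algebraType (cylinders X I2).
  have : measurable ([set w | (`|W n w - W k w| < l)%R] : set future).
    rewrite (_ : [set w | _] =
        [set w | (`|S k.+1 n.+1 w - (n.+1 - k.+1)%:R * mu| < l)%R]).
      apply: (@measurable_norm_lt _ future).
      apply: measurable_funB => //.
      exact: measurable_block_sum.
    by apply/funext => w /=; rewrite WE.
  exact.
Qed.

End truncated_sums.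

(** * The upper bound *)

Section marcinkiewicz_zygmund.
Context d (T : measurableType d) (R : realType) (P : probability T R).
Variables (alpha b : R).
Hypothesis a1 : 1 < alpha.
Hypothesis a2 : alpha < 2.
Variable X : nat -> {RV P >-> R}.
Hypothesis iidX : iid X.

Local Notation a := (powlog alpha^-1 b).
Local Notation g := (powlog alpha (- (b * alpha))).

Hypothesis gfin : (\int[P]_w (g `|X 0%N w|)%:E < +oo)%E.

Let mnX i : measurable_fun setT (fun w => `|X i w|).
Proof. exact: measurableT_comp. Qed.

Let mgX : measurable_fun setT (fun w => g `|X 0%N w|).
Proof. exact: measurableT_comp (measurable_powlog _ _) (mnX 0%N). Qed.

Let ig : P.-integrable setT (EFin \o (fun w => g `|X 0%N w|)).
Proof.
apply/integrableP; split; first exact/measurable_EFinP.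
by under eq_integral do rewrite /= ger0_norm ?powlog_ge0//.
Qed.

Lemma moment_integrable : P.-integrable setT (EFin \o X 0%N).
Proof.
have [K K0 KP] := moment_first b a1.
apply: (@le_integrable _ _ _ P setT measurableT _
    ((EFin \o cst (a 1)) \+
     (fun w => (K * a 1)%:E * (EFin \o (fun w => g `|X 0%N w|)) w))%E).
- exact/measurable_EFinP.
- move=> w _ /=; rewrite lee_fin [leRHS]ger0_norm; last first.
    apply: addr_ge0; rewrite ?powlog_ge0// mulr_ge0 ?powlog_ge0//.
    by rewrite mulr_ge0 ?powlog_ge0// ltW.
  have [h|h] := leP (a 1) `|X 0%N w|.
    have := KP 1 _ (lexx _) h; rewrite mul1r => /le_trans; apply.
    by rewrite lerDr powlog_ge0.
  rewrite (le_trans (ltW h))// lerDl mulr_ge0 ?powlog_ge0//.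
  by rewrite mulr_ge0 ?powlog_ge0// ltW.
- apply: integrableD => //; first exact: finite_measure_integrable_cst.
  exact: integrableZl.
Qed.

Let mu := fine 'E_P[X 0%N]%E.
Let c j : R := a (2 ^+ j).
Let trunc j (x : R) := if `|x| <= c j then x else 0.
Let m j := fine 'E_P[trunc j \o X 0%N]%E.

Let c0 j : 0 < c j.
Proof. by rewrite powlog_gt0// exprn_gt0. Qed.

Let p2 j : 1 <= (2 : R) ^+ j.
Proof. by rewrite exprn_ege1// ler1n. Qed.

Let mtrunc j : measurable_fun setT (trunc j).
Proof.
apply: measurable_fun_ifT => //.
by apply: measurable_fun_ler => //; exact: measurableT_comp.
Qed.

Let truncM j x : `|trunc j x| <= c j.
Proof. by rewrite /trunc; case: ifP => // _; rewrite normr0 ltW. Qed.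

Let i_trunc j : P.-integrable setT (EFin \o (trunc j \o X 0%N)).
Proof.
apply/Lfun1_integrable/Lfun21/(@bounded_Lfun2 _ _ _ _ _ (c j)).
  exact: measurableT_comp.
by move=> w; exact: truncM.
Qed.

(** The expectation of |X| over |X| > c j is at most a constant times
    c j / 2^j times the expectation of g(|X|), by [moment_first]. *)
Lemma truncated_mean : exists2 K, 0 <= K & forall j, 2 ^+ j * `|m j - mu| <= K * c j.
Proof.
have [K K0 KP] := moment_first b a1.
have iX := moment_integrable.
pose G := fine (\int[P]_w (g `|X 0%N w|)%:E).
have GE : (\int[P]_w (g `|X 0%N w|)%:E)%E = G%:E.
  by rewrite fineK// ge0_fin_numE// integral_ge0// => w _; rewrite lee_fin powlog_ge0.
have G0 : 0 <= G.
  by rewrite -lee_fin -GE integral_ge0// => w _; rewrite lee_fin powlog_ge0.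
exists (K * G); first by rewrite mulr_ge0// ltW.
move=> j; rewrite -lee_fin EFinM.
have -> : `|m j - mu|%:E = (`|\int[P]_w (trunc j (X 0%N w) - X 0%N w)%:E|)%E.
  have f1 : (\int[P]_w (trunc j (X 0%N w))%:E)%E \is a fin_num.
    exact: integrable_fin_num (i_trunc j).
  have f2 : (\int[P]_w (X 0%N w)%:E)%E \is a fin_num.
    exact: integrable_fin_num iX.
  rewrite /m /mu unlock.
  rewrite (_ : (\int[P]_w (trunc j (X 0%N w) - X 0%N w)%:E)%E =
     (\int[P]_w (trunc j (X 0%N w))%:E - \int[P]_w (X 0%N w)%:E)%E); last first.
    exact: (integralB_EFin measurableT (i_trunc j) iX).
  rewrite -[X in (`|X|)%E]fineK; last first.
    by rewrite fin_numB f1 f2.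
  by rewrite (fineB f1 f2) abse_EFin.
have mD : measurable_fun setT (fun w => trunc j (X 0%N w) - X 0%N w).
  by apply: measurable_funB => //; exact: measurableT_comp.
apply: (@le_trans _ _ ((2 ^+ j)%:E *
    \int[P]_w (`|(trunc j (X 0%N w) - X 0%N w)%:E|))%E).
  rewrite lee_wpmul2l ?lee_fin ?exprn_ge0//.
  by apply: le_abse_integral => //; exact/measurable_EFinP.
rewrite -ge0_integralZl_EFin//; last first.
  by apply: measurableT_comp => //; exact/measurable_EFinP.
rewrite mulrAC EFinM -GE -ge0_integralZl_EFin//; last 3 first.
  by move=> w _; rewrite lee_fin powlog_ge0.
  exact/measurable_EFinP.
  by rewrite mulr_ge0// ltW.
apply: ge0_le_integral => //.
- apply: emeasurable_funM => //.
  by apply: measurableT_comp => //; exact/measurable_EFinP.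
- by apply: emeasurable_funM => //; exact/measurable_EFinP.
move=> w _; rewrite abse_EFin -!EFinM lee_fin /trunc; case: ifPn => h.
  by rewrite subrr normr0 mulr0 mulr_ge0 ?powlog_ge0// mulr_ge0 ?powlog_ge0// ltW.
rewrite sub0r normrN; apply: KP => //.
by move: h; rewrite -ltNge => /ltW.
Qed.

(** As a function of |X|, a quantity whose mean bounds the probability of the
    bad event of the j-th block: the union bound for the truncation, and the
    maximal inequality for the truncated sums. *)
Let psi j (z : R) := 2 ^+ j * (c j < z)%R%:R +
  2 * (2 ^+ j / c j ^+ 2 * (z ^+ 2 * (z <= c j)%R%:R)).

Let psi2_ge0 j z :
  0 <= 2 * (2 ^+ j / c j ^+ 2 * (z ^+ 2 * (z <= c j)%R%:R)).
Proof.
have cc : 0 <= 2 ^+ j / c j ^+ 2 by rewrite divr_ge0 ?exprn_ge0// ltW.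
by rewrite mulr_ge0// mulr_ge0// mulr_ge0// sqr_ge0.
Qed.

Let psi_ge0 j z : 0 <= psi j z.
Proof.
by rewrite /psi addr_ge0 ?psi2_ge0// mulr_ge0// exprn_ge0.
Qed.

Let mb (f h : R -> R) : measurable_fun setT f -> measurable_fun setT h ->
  measurable_fun setT (fun z => (f z <= h z)%R%:R : R) /\
  measurable_fun setT (fun z => (f z < h z)%R%:R : R).
Proof.
move=> mf mh; split.
  rewrite (_ : (fun _ => _) = (fun z => if f z <= h z then 1 else 0)).
    by apply: measurable_fun_ifT => //; exact: measurable_fun_ler.
  by apply/funext => z; case: ifP.
rewrite (_ : (fun _ => _) = (fun z => if f z < h z then 1 else 0)).
  by apply: measurable_fun_ifT => //; exact: measurable_fun_ltr.
by apply/funext => z; case: ifP.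
Qed.

Let mpsi j : measurable_fun setT (psi j).
Proof.
have [m1 _] := mb (@measurable_id _ R setT) (@measurable_cst _ _ R R setT (c j)).
have [_ m2] := mb (@measurable_cst _ _ R R setT (c j)) (@measurable_id _ R setT).
apply: measurable_funD; first exact: measurable_funM.
apply: measurable_funM => //; apply: measurable_funM => //.
by apply: measurable_funM => //; exact: measurable_funX.
Qed.

Let psi_sum : exists2 K, 0 < K &
  forall N z, 0 <= z -> \sum_(j < N) psi j z <= K * g z.
Proof.
have [K K0 KP] := dyadic_tail_sum b a1.
have [L L0 LP] := dyadic_second_moment_sum b a1 a2.
exists (K + 2 * L); first by rewrite addr_gt0 ?mulr_gt0.
move=> N z z0; rewrite /psi big_split/= -mulr_sumr [leRHS]mulrDl lerD ?KP//.
by rewrite -mulrA ler_pM2l// LP.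
Qed.

Let bad j := \big[setU/set0]_(i < 2 ^ j) [set w | c j < `|X i.+1 w|] `|`
  \big[setU/set0]_(k < (2 ^ j).+1) [set w | 2 * c j <=
     `|\sum_(1 <= i < k.+1) trunc j (X i w) - k%:R * m j| ].

Let mtail i (t : R) : measurable [set w | t < `|X i w|].
Proof.
exact: measurable_norm_gt.
Qed.

Let mbad j : measurable (bad j).
Proof.
apply: measurableU; apply: bigsetU_measurable => i _; first exact: mtail.
apply: measurable_norm_ge; apply: measurable_funB => //.
by apply: measurable_sum => k; exact: measurableT_comp.
Qed.

Let Pbad j : (P (bad j) <= \int[P]_w (psi j `|X 0%N w|)%:E)%E.
Proof.
rewrite (le_trans (measureU2 _ _ _))//.
- by apply: bigsetU_measurable => i _; exact: mtail.
- apply: bigsetU_measurable => i _.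
  apply: measurable_norm_ge; apply: measurable_funB => //.
  by apply: measurable_sum => k; exact: measurableT_comp.
have [_ mlt] := mb (@measurable_cst _ _ R R setT (c j)) (@measurable_id _ R setT).
have [mle _] := mb (@measurable_id _ R setT) (@measurable_cst _ _ R R setT (c j)).
under eq_integral do rewrite EFinD.
rewrite ge0_integralD//=; last 3 first.
- apply/measurable_EFinP; apply: measurable_funM => //.
  exact: measurableT_comp mlt (mnX 0%N).
- by move=> w _; rewrite lee_fin psi2_ge0.
- apply/measurable_EFinP; apply: measurable_funM => //; apply: measurable_funM => //.
  apply: measurable_funM => //; first exact: measurable_funX.
  exact: measurableT_comp mle (mnX 0%N).
apply: leeD.
  under eq_integral do rewrite EFinM.
  rewrite ge0_integralZl_EFin//; last first.
    by apply/measurable_EFinP; exact: measurableT_comp mlt (mnX 0%N).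
  have -> : (\int[P]_w ((c j < `|X 0%N w|)%R%:R)%:E)%E = P [set w | c j < `|X 0%N w|].
    rewrite -[in RHS](setIT [set w | c j < `|X 0%N w|]) -integral_indic//.
    apply: eq_integral => w _; rewrite indicE; congr (_%:R)%:E.
    apply/esym; case: (boolP (c j < _)) => h; first by rewrite mem_set.
    by rewrite memNset//; exact/negP.
  have Pi i : P [set w | c j < `|X i w|] = P [set w | c j < `|X 0%N w|].
    have mB : measurable [set x : R | c j < `|x|].
      exact: (@measurable_norm_gt _ R R id).
    exact: (iidX.2 i 0%N _ mB).
  have : forall N, (P (\big[setU/set0]_(i < N) [set w | (c j < `|X i.+1 w|)%R]) <=
     N%:R%:E * P [set w | (c j < `|X 0%N w|)%R])%E.
    elim=> [|N IH]; first by rewrite big_ord0 measure0 mul0e.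
    rewrite big_ord_recr/= (le_trans (measureU2 _ _ _))//.
      by apply: bigsetU_measurable => i _; exact: mtail.
    rewrite -natr1 EFinD muleDl//; last by rewrite fin_num_measure.
    by apply: leeD => //; rewrite mul1e -[leRHS](Pi N.+1).
  by move=> /(_ (2 ^ j)%N); rewrite natrX.
rewrite (le_trans (maximal_inequality iidX (mtrunc j) (truncM j) _ (c0 j)))//.
have c2 : 0 <= 2 * (c j ^- 2 * (2 ^ j)%:R).
  by rewrite mulr_ge0// mulr_ge0// invr_ge0 sqr_ge0.
rewrite unlock -ge0_integralZl_EFin//; last 2 first.
- by move=> w _; rewrite lee_fin sqr_ge0.
- apply/measurable_EFinP; apply: measurable_funX.
  exact: measurableT_comp.
apply: ge0_le_integral => //.
- by move=> w _; rewrite -EFinM lee_fin (mulr_ge0 c2)// sqr_ge0.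
- apply/measurable_EFinP; apply: measurable_funM => //; apply: measurable_funX.
  exact: measurableT_comp.
- apply/measurable_EFinP; apply: measurable_funM => //; apply: measurable_funM => //.
  apply: measurable_funM => //; first exact: measurable_funX.
  exact: measurableT_comp mle (mnX 0%N).
move=> w _; rewrite -EFinM lee_fin natrX /trunc.
case: ifPn => h; last by rewrite expr0n/= !mulr0.
by rewrite mulr1 real_normK ?num_real// (mulrC _ (2 ^+ j)) -!mulrA.
Qed.

Let bad_null : P (lim_sup_set bad) = 0%E.
Proof.
apply: lim_sup_set_cvg0 => //.
have [K K0 KP] := psi_sum.
have [G GE] : exists G, (\int[P]_w (g `|X 0%N w|)%:E)%E = G%:E.
  exists (fine (\int[P]_w (g `|X 0%N w|)%:E)).
  by rewrite fineK// ge0_fin_numE// integral_ge0// => w _; rewrite lee_fin powlog_ge0.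
apply: (@le_lt_trans _ _ (K * G)%:E); last exact: ltry.
apply: lime_le; first by apply: is_cvg_nneseries => n _ _; exact: measure_ge0.
apply: nearW => N; rewrite big_mkord.
apply: (@le_trans _ _ (\sum_(j < N) \int[P]_w (psi j `|X 0%N w|)%:E)%E).
  by apply: lee_sum => j _; exact: Pbad.
have mp j : measurable_fun setT (fun w => (psi j `|X 0%N w|)%:E).
  by apply/measurable_EFinP; exact: measurableT_comp (mpsi j) (mnX 0%N).
rewrite -ge0_integral_sum//; last first.
  by move=> j w _; rewrite lee_fin psi_ge0.
rewrite EFinM -GE -ge0_integralZl_EFin//; last 3 first.
- by move=> w _; rewrite lee_fin powlog_ge0.
- exact/measurable_EFinP.
- exact: ltW.
apply: ge0_le_integral => //.
- by move=> w _; rewrite sume_ge0// => j _; rewrite lee_fin psi_ge0.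
- exact: emeasurable_sum.
- by apply: emeasurable_funM => //; exact/measurable_EFinP.
by move=> w _; rewrite sumEFin -EFinM lee_fin KP.
Qed.

(** By the first Borel-Cantelli lemma only finitely many blocks are bad.  An
    index n belongs to the block j with 2^(j-1) <= n < 2^j, on which c j is at
    most a constant times a n. *)
Theorem marcinkiewicz_zygmund : exists2 C, 0 < C &
  {ae P, forall w, exists N, forall n, (N <= n)%N ->
    `|partial_sum X n w - n%:R * mu| <= C * a n%:R}.
Proof.
have [K K0 KP] := truncated_mean.
have [L L0 LP] := norming_dyadic b a1.
exists ((2 + K) * L); first by rewrite mulr_gt0// ltr_wpDr.
exists (lim_sup_set bad); split => //.
  apply: bigcap_measurable => //; last by move=> k _; apply: bigcup_measurable.
move=> w /= nE; apply: contrapT => nbad; apply: nE.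
have [J JP] : exists J, forall j, (J <= j)%N -> ~ bad j w.
  apply: contrapT => h; apply: nbad => J _.
  apply: contrapT => h2; apply: h; exists J => j Jj bj; apply: h2.
  by exists j.
exists (2 ^ J)%N => n Jn.
have n0 : (0 < n)%N by rewrite (leq_trans _ Jn)// expn_gt0.
pose j := (trunc_log 2 n).+1.
have nj : (n <= 2 ^ j)%N by rewrite ltnW// trunc_log_ltn.
have jn : (2 ^ j <= 2 * n)%N by rewrite expnS leq_mul2l/= trunc_logP.
have Jj : (J <= j)%N.
  by rewrite -(leq_exp2l (m := 2))// (leq_trans Jn).
move: (JP _ Jj) => /not_orP[nb1 nb2].
have small i : (1 <= i < n.+1)%N -> trunc j (X i w) = X i w.
  move=> /andP[i1 iN]; rewrite /trunc; case: ifPn => //; rewrite -ltNge => big.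
  exfalso; apply: nb1.
  rewrite -(bigcup_mkord (2 ^ j) (fun i => [set w | c j < `|X i.+1 w|])).
  exists i.-1 => /=.
    by rewrite prednK// (leq_trans _ nj).
  by rewrite prednK.
have dev : `|partial_sum X n w - n%:R * m j| < 2 * c j.
  rewrite ltNge; apply/negP => big; apply: nb2.
  rewrite -(bigcup_mkord _ (fun k => [set w | 2 * c j <=
     `|\sum_(1 <= i < k.+1) trunc j (X i w) - k%:R * m j|])); exists n => //=.
  rewrite (le_trans big)//.
  have -> : \sum_(1 <= i < n.+1) trunc j (X i w) = partial_sum X n w.
    by apply: eq_big_nat => i /small.
  exact: lexx.
have cj : c j <= L * a n%:R.
  rewrite /c; apply: LP; rewrite ?ler1n//.
  by rewrite -natrX -natrM ler_nat.
have drift : n%:R * `|m j - mu| <= K * c j.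
  apply: le_trans (KP j); rewrite ler_wpM2r//.
  by rewrite -natrX ler_nat.
have -> : partial_sum X n w - n%:R * mu =
    (partial_sum X n w - n%:R * m j) + n%:R * (m j - mu) by ring.
rewrite (le_trans (ler_normD _ _))// normrM normr_nat.
rewrite (le_trans (lerD (ltW dev) drift))// -mulrDl -mulrA ler_wpM2l//.
by rewrite addr_ge0.
Qed.

End marcinkiewicz_zygmund.

(** * The lower bound *)

Section borel_cantelli_2.
Context d (T : measurableType d) (R : realType) (P : probability T R).
Variable X : nat -> {RV P >-> R}.
Hypothesis indX : mutually_independent X.
Variable B : nat -> set R.
Hypothesis mB : forall n, measurable (B n).

Let A n := X n @^-1` B n.

Let mA n : measurable (A n).
Proof. by rewrite -[X in measurable X]setTI; exact: measurable_funP. Qed.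

Let none N k := \big[setI/setT]_(i < k) ~` A (N + i)%N.

Let mnone N k : measurable (none N k).
Proof. by apply: bigsetI_measurable => i _; exact: measurableC. Qed.

(** The last event is split off by [independent_blocks], and its factor
    1 - P(A n) is at most exp(- P(A n)). *)
Let none_le N k :
  (P (none N k) <= (expR (- \sum_(i < k) fine (P (A (N + i)%N))))%:E)%E.
Proof.
elim: k => [|k IH]; first by rewrite /none !big_ord0 probability_setT oppr0 expR0.
rewrite {1}/none big_ord_recr/= -/(none N k) big_ord_recr/= opprD expRD EFinM.
pose I1 := [set i | (i < N + k)%N]; pose I2 := [set (N + k)%N].
rewrite (independent_blocks indX (I1 := I1) (I2 := I2)); last 3 first.
- by apply/seteqP; split => // i [] /[swap] /= ->; rewrite /I1 /= ltnn.
- have : measurable (none N k : set (g_sigma_algebraType (cylinders X I1))).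
    apply: bigsetI_measurable => i _; apply: measurableC.
    have mi : measurable_fun setT
        (X (N + i)%N : g_sigma_algebraType (cylinders X I1) -> R).
      by apply: measurable_coordinate; rewrite /I1/= ltn_add2l.
    by rewrite -[X in measurable X]setTI; exact: mi.
  exact.
- have : measurable (~` A (N + k)%N : set (g_sigma_algebraType (cylinders X I2))).
    apply: measurableC.
    have mi : measurable_fun setT
        (X (N + k)%N : g_sigma_algebraType (cylinders X I2) -> R).
      exact: measurable_coordinate.
    by rewrite -[X in measurable X]setTI; exact: mi.
  exact.
apply: lee_pmul => //.
rewrite probability_setC// -[X in (_ - X)%E](fineK (fin_num_measure P _ (mA _))).
by rewrite -EFinB lee_fin expR_ge1Dx.
Qed.

(** Unbounded partial sums stay unbounded when the first N terms are removed,
    so the bound exp(- sum) on P(none N k) tends to 0. *)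
Lemma borel_cantelli_2 :
  (forall M : R, exists k, M < \sum_(n < k) fine (P (A n))) ->
  {ae P, forall w, forall N, exists2 n, (N <= n)%N & B n (X n w)}.
Proof.
move=> unb.
have z N : P (\bigcap_k none N k) = 0%E.
  apply/eqP; rewrite eq_le measure_ge0 andbT.
  set Q := P _.
  have mC : measurable (\bigcap_k none N k) by exact: bigcapT_measurable.
  have QE : Q = (fine Q)%:E by rewrite fineK// fin_num_measure.
  rewrite QE lee_fin leNgt; apply/negP => Q0.
  have [k] := unb (- ln (fine Q) + \sum_(n < N) fine (P (A n))).
  have [kN|Nk] := leqP k N.
    rewrite -(subnKC kN) big_split_ord/= => h.
    have : 0 <= \sum_(i < N - k) fine (P (A (k + i)%N)).
      by apply: sumr_ge0 => i _; rewrite fine_ge0.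
    have : fine Q <= 1 by rewrite -lee_fin -QE probability_le1.
    by move=> /ln_le0; lra.
  have [m ->] : exists m, k = (N + m)%N by exists (k - N)%N; rewrite subnKC// ltnW.
  rewrite big_split_ord/= [X in X < _]addrC ltrD2l => h.
  have : fine Q <= expR (- \sum_(i < m) fine (P (A (N + i)%N))).
    rewrite -lee_fin -QE (le_trans _ (none_le _ _))//.
    by apply: le_measure; rewrite ?inE//; exact: bigcap_inf.
  rewrite -ler_ln ?posrE ?expR_gt0// expRK.
  by rewrite lerNr leNgt h.
have nz N : P.-negligible (\bigcap_k none N k).
  by exists (\bigcap_k none N k); split => //; exact: bigcapT_measurable.
apply: negligibleS (negligible_bigcup nz) => w /= /existsNP[N hN]; exists N => // k _.
rewrite /none -(bigcap_mkord k (fun i => ~` A (N + i)%N)) => i /= _ Aw.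
by apply: hN; exists (N + i)%N => //; exact: leq_addr.
Qed.

End borel_cantelli_2.

Section tail_sum.
Context d (T : measurableType d) (R : realType) (P : probability T R).

(** A nonnegative W is at most the number of integers n with n <= W. *)
Lemma integrable_of_tail_sum (W : T -> R) (M : R) :
  measurable_fun setT W -> (forall w, 0 <= W w) ->
  (forall k, \sum_(n < k) fine (P [set w | n%:R <= W w]) <= M) ->
  (\int[P]_w (W w)%:E < +oo)%E.
Proof.
move=> mW W0 bnd.
have mS n : measurable [set w | n%:R <= W w].
  rewrite (_ : [set w | _] = [set w | n%:R <= `|W w|]); first exact: measurable_norm_ge.
  by apply/funext => w /=; rewrite ger0_norm.
apply: (@le_lt_trans _ _ M%:E); last exact: ltry.
apply: (@le_trans _ _ (\int[P]_w \sum_(n <oo) (\1_[set w | n%:R <= W w] w)%:E)%E).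
  apply: ge0_le_integral => //.
  - by move=> w _; rewrite lee_fin.
  - exact/measurable_EFinP.
  - apply: ge0_emeasurable_sum => [n w _ _|n _]; first by rewrite lee_fin.
    by apply/measurable_EFinP; exact: measurable_indic.
  move=> w _.
  have H := @nneseries_lim_ge R (fun n => (\1_[set w | n%:R <= W w] w)%:E)
    xpredT 0 (Num.truncn (W w)).+1.
  apply: le_trans; last by apply: H => n _ _; rewrite lee_fin.
  rewrite sumEFin lee_fin big_mkord (eq_bigr (fun=> 1)); last first.
    move=> i _; rewrite indicE mem_set//=.
    have := ltn_ord i; rewrite ltnS => iW.
    by rewrite -truncn_ge_nat.
  rewrite sumr_const card_ord ltW//.
  by rewrite truncnS_gt.
rewrite integral_nneseries//; last first.
  by move=> n; apply/measurable_EFinP; exact: measurable_indic.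
apply: lime_le; first by apply: is_cvg_nneseries => n _ _; exact: integral_ge0.
apply: nearW => k; rewrite big_mkord.
rewrite (eq_bigr (fun n : 'I_k => (fine (P [set w | n%:R <= W w]))%:E)); last first.
  by move=> n _; rewrite integral_indic// setIT fineK// fin_num_measure.
by rewrite sumEFin lee_fin; exact: bnd.
Qed.

End tail_sum.

Section heavy_tails.
Context d (T : measurableType d) (R : realType) (P : probability T R).
Variables (alpha b : R).
Hypothesis a1 : 1 < alpha.
Variable X : nat -> {RV P >-> R}.
Hypothesis iidX : iid X.

Local Notation a := (powlog alpha^-1 b).
Local Notation g := (powlog alpha (- (b * alpha))).

Hypothesis ginf : ~ (\int[P]_w (g `|X 0%N w|)%:E < +oo)%E.

(** By [borel_cantelli_2] it suffices that the sum of P(|X| > C a n) diverges.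
    Were it bounded, so would be the sum of P(g(|X|) >= 2 K n), because
    g(|X|) >= 2 K n implies |X| > C a n for n >= 1; then g(|X|) would be
    integrable. *)
Lemma exceed_infinitely_often (C : R) : 1 <= C ->
  {ae P, forall w, forall N, exists2 n, (N <= n)%N & C * a n%:R < `|X n w|}.
Proof.
move=> C1; have [K K0 KP] := moment_tail_le b a1 C1.
have mB n : measurable [set x : R | C * a n%:R < `|x|].
  exact: (@measurable_norm_gt _ R R id).
apply: (@borel_cantelli_2 _ _ _ P X iidX.1
  (fun n => [set x : R | C * a n%:R < `|x|]) mB).
move=> M; apply: contrapT => h; apply: ginf.
have bnd k : \sum_(n < k) fine (P (X n @^-1` [set x | C * a n%:R < `|x|])) <= M.
  by rewrite leNgt; apply/negP => Mk; apply: h; exists k.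
(* The factor 2 makes the comparison strict, so that the non-strict tail sum of
   W matches the strict inequality defining an exceedance. *)
pose W w := (2 * K)^-1 * g `|X 0%N w|.
have K2 : 0 < 2 * K by rewrite mulr_gt0.
have mgX : measurable_fun setT (fun w => g `|X 0%N w|).
  by apply: (measurableT_comp (measurable_powlog _ _)); exact: measurableT_comp.
have mW : measurable_fun setT W by exact: measurable_funM.
have W0 w : 0 <= W w by rewrite mulr_ge0 ?powlog_ge0// invr_ge0 ltW.
have gE w : g `|X 0%N w| = 2 * K * W w by rewrite /W mulrA divff ?mul1r// gt_eqF.
under eq_integral do rewrite gE EFinM.
have mS n : measurable [set w | n%:R <= W w].
  rewrite (_ : [set w | _] = [set w | n%:R <= `|W w|]); first exact: measurable_norm_ge.
  by apply/funext => w /=; rewrite ger0_norm.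
have Pn n : fine (P [set w | n.+1%:R <= W w]) <=
    fine (P (X n.+1 @^-1` [set x | C * a n.+1%:R < `|x|])).
  apply: fine_le; rewrite ?fin_num_measure//.
    by rewrite -[X in measurable X]setTI; exact: measurable_funP.
  rewrite [leRHS](iidX.2 n.+1 0%N _ (mB n.+1)).
  apply: le_measure; rewrite ?inE//.
    by rewrite -[X in measurable X]setTI; exact: measurable_funP.
  move=> w /= nW; rewrite ltNge; apply/negP => small.
  have n1 : 1 <= n.+1%:R :> R by rewrite ler1n.
  have := KP _ _ n1 (normr_ge0 _) small; rewrite gE => h2.
  have : K * (2 * W w) <= K * n.+1%:R by lra.
  by rewrite ler_pM2l//; lra.
have M0 : 0 <= M by apply: le_trans (bnd 0%N); rewrite big_ord0.
have bW k : \sum_(n < k) fine (P [set w | n%:R <= W w]) <= 1 + M.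
  case: k => [|k]; first by rewrite big_ord0 addr_ge0.
  rewrite big_ord_recl lerD//.
    by rewrite -lee_fin fineK ?fin_num_measure// probability_le1.
  apply: le_trans (bnd k.+1); rewrite big_ord_recl.
  rewrite -[leLHS]add0r lerD ?fine_ge0//; apply: ler_sum => n _.
  exact: Pn.
rewrite ge0_integralZl_EFin//; last 3 first.
- by move=> w _; rewrite lee_fin.
- exact/measurable_EFinP.
- exact: ltW.
have := integrable_of_tail_sum mW W0 bW.
by apply: lte_mul_pinfty; rewrite ?lee_fin// ltW.
Qed.

(** Were |S_n| <= a n from some index on, |X_n| <= |S_n| + |S_(n-1)| would
    eventually be at most (1 + K) a n, where K accounts for the lack of
    monotonicity of [a]. *)
Lemma partial_sums_exceed :
  {ae P, forall w, forall N, exists2 n, (N <= n)%N & a n%:R < `|partial_sum X n w|}.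
Proof.
have av0 : 0 < alpha^-1 by rewrite invr_gt0 (lt_trans ltr01 a1).
have [K K0 KP] := powlog_incr b av0.
have C1 : 1 <= 1 + K by rewrite lerDl ltW.
apply: filterS (exceed_infinitely_often C1) => w h N.
apply: contrapT => none.
have small n : (N <= n)%N -> `|partial_sum X n w| <= a n%:R.
  by move=> Nn; rewrite leNgt; apply/negP => big; apply: none; exists n.
have [n Nn] := h N.+1; apply/negP; rewrite -leNgt.
case: n Nn => // n; rewrite ltnS => Nn.
have -> : X n.+1 w = partial_sum X n.+1 w - partial_sum X n w.
  by rewrite /partial_sum big_nat_recr//= [X in X - _]addrC addrK.
rewrite (le_trans (ler_normB _ _))// mulrDl mul1r lerD//.
  exact/small/leqW.
by rewrite (le_trans (small _ Nn))// KP// ler_nat.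
Qed.

End heavy_tails.

(** * From growth rates to the limit superior *)

Section limit_superior.
Context {R : realType}.
Local Open Scope ereal_scope.
Implicit Types (u : (\bar R)^nat) (l : \bar R).

Lemma limn_esup_le u l : (exists N, forall n, (N <= n)%N -> u n <= l) ->
  limn_esup u <= l.
Proof.
move=> [N ul]; rewrite /limn_esup limf_esupE.
apply: (@le_trans _ _ (ereal_sup (u @` [set n | (N <= n)%N]))).
  by apply: ereal_inf_lbound; exists [set n | (N <= n)%N] => //; exists N.
by apply: ge_ereal_sup => _ [n /= Nn <-]; exact: ul.
Qed.

Lemma limn_esup_ge u l : (forall N, exists2 n, (N <= n)%N & l <= u n) ->
  l <= limn_esup u.
Proof.
move=> ul; rewrite /limn_esup limf_esupE.
apply: le_ereal_inf_tmp => _ [V [N _ NV] <-].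
have [n Nn ln] := ul N; apply: le_trans ln _.
by apply: ereal_sup_ubound; exists n => //; exact: NV.
Qed.

End limit_superior.

Section loglog_root.
Context {R : realType}.
Variables (alpha b : R).
Local Notation a := (powlog alpha^-1 b).

Lemma loglog_large (M : R) : exists N, forall n, (N <= n)%N ->
  [/\ M <= ln (ln n%:R), 0 < ln (ln (n%:R : R)), 0 < (n%:R : R) &
      Llog (n%:R : R) = expR (ln (ln n%:R))].
Proof.
pose M' := Num.max M 1; have M1 : 1 <= M' by rewrite le_max lexx orbT.
exists (Num.truncn (expR (expR M'))).+1 => n; rewrite -(ler_nat R) => Nn.
have en : expR (expR M') <= n%:R.
  by rewrite (le_trans _ Nn)// ltW// truncnS_gt.
have n0 : 0 < (n%:R : R) by rewrite (lt_le_trans _ en)// expR_gt0.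
have ln1 : expR M' <= ln n%:R by rewrite -ler_expR lnK.
have ln0 : 0 < ln (n%:R : R) by rewrite (lt_le_trans _ ln1)// expR_gt0.
have MD : M' <= ln (ln n%:R) by rewrite -ler_expR lnK.
split => //.
- by rewrite (le_trans _ MD)// le_max lexx.
- by rewrite (lt_le_trans _ MD)// (lt_le_trans _ M1).
rewrite lnK// Llog_ln// (le_trans _ en)// ler_expR (le_trans _ (expR_ge1Dx _))//.
by rewrite lerDl (le_trans _ M1).
Qed.

Lemma root_le (y D c : R) : 0 <= y -> 0 < D ->
  (y `^ D^-1 <= expR c) = (y <= expR (c * D)).
Proof.
move=> y0 D0; have Di : 0 < D^-1 by rewrite invr_gt0.
have -> : expR c = expR (c * D) `^ D^-1.
  by rewrite expRM -powRrM divff ?powRr1 ?expR_ge0// gt_eqF.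
apply/idP/idP => [|h]; last first.
  by apply: ge0_ler_powR; rewrite ?nnegrE ?expR_ge0// ltW.
apply: contraTT; rewrite -!ltNge => h.
by apply: gt0_ltr_powR; rewrite ?nnegrE ?expR_ge0.
Qed.

(** With D = log (log n), the factor (log n)^b equals exp(b D) and the exponent
    1/D turns it into exp b. *)
Lemma norming_loglog : exists N, forall n, (N <= n)%N -> forall (s c : R),
  (`|s / n%:R `^ alpha^-1| `^ (ln (ln n%:R))^-1 <= expR (b + c)) =
  (`|s| <= expR (c * ln (ln n%:R)) * a n%:R).
Proof.
have [N NP] := loglog_large 1; exists N => n Nn s c.
have [_ D0 n0 LE] := NP _ Nn.
have p0 : 0 < n%:R `^ alpha^-1 by rewrite powR_gt0.
rewrite root_le// normrM normfV (ger0_norm (ltW p0)) ler_pdivrMr//.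
by rewrite /powlog LE -expRM (mulrC _ b) mulrDl expRD; congr (_ <= _); ring.
Qed.

Variable S : nat -> R.
Local Notation root := (fun n : nat =>
  (`|S n / n%:R `^ alpha^-1| `^ (ln (ln n%:R))^-1)%:E).

(** A constant factor C is absorbed by exp((b' - b) log (log n)). *)
Lemma root_limsup_le (C b' : R) : 0 < C -> b < b' ->
  (exists N, forall n, (N <= n)%N -> `|S n| <= C * a n%:R) ->
  (limn_esup root <= (expR b')%:E)%E.
Proof.
move=> C0 bb' [N1 H1]; have [N2 H2] := norming_loglog.
have d0 : 0 < b' - b by rewrite subr_gt0.
have [N3 H3] := loglog_large (ln C / (b' - b)).
apply: limn_esup_le; exists (maxn N1 (maxn N2 N3)) => n.
rewrite !geq_max => /and3P[n1 n2 n3]; have [MD _ _ _] := H3 _ n3.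
rewrite lee_fin (_ : b' = b + (b' - b)); last by ring.
rewrite H2// (le_trans (H1 _ n1))// ler_wpM2r ?powlog_ge0//.
by rewrite -[leLHS]lnK ?posrE// ler_expR -ler_pdivrMl// mulrC.
Qed.

Lemma root_limsup_ge :
  (forall N, exists2 n, (N <= n)%N & a n%:R < `|S n|) ->
  ((expR b)%:E <= limn_esup root)%E.
Proof.
move=> H1; have [N2 H2] := norming_loglog.
apply: limn_esup_ge => N; have [n Nn aS] := H1 (maxn N N2).
move: Nn; rewrite geq_max => /andP[Nn n2]; exists n => //.
rewrite lee_fin ltW// ltNge -[b in expR b]addr0 H2// mul0r expR0 mul1r.
by rewrite -ltNge.
Qed.

End loglog_root.

Section almost_sure.
Context d (T : measurableType d) (R : realType) (P : probability T R).

Lemma ae_exists (Q : T -> Prop) : {ae P, forall w, Q w} -> exists w, Q w.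
Proof.
move=> aeQ; apply: contrapT => nQ.
have /negligibleP : P.-negligible [set: T].
  by apply: negligibleS aeQ => w _ Qw; apply: nQ; exists w.
move=> /(_ measurableT) P0.
have /eqP := etrans (esym P0) (probability_setT P).
by rewrite eq_sym onee_eq0.
Qed.

End almost_sure.

Section moments.
Context d (T : measurableType d) (R : realType) (P : probability T R).
Variables (alpha : R) (X : nat -> {RV P >-> R}).
Hypothesis a1 : 1 < alpha.

Lemma moment_expectationE b :
  ('E_P[fun w => (`|X 0%N w| `^ alpha / Llog `|X 0%N w| `^ (b * alpha))%R])%E =
  (\int[P]_w (powlog alpha (- (b * alpha)) `|X 0%N w|)%:E)%E.
Proof.
rewrite unlock; apply: eq_integral => w _.
by rewrite /powlog powRN.
Qed.

Lemma moment_mono b b' : b <= b' ->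
  (\int[P]_w (powlog alpha (- (b * alpha)) `|X 0%N w|)%:E < +oo)%E ->
  (\int[P]_w (powlog alpha (- (b' * alpha)) `|X 0%N w|)%:E < +oo)%E.
Proof.
move=> bb'; apply: le_lt_trans.
have m c : measurable_fun setT (fun w => powlog alpha (- (c * alpha)) `|X 0%N w|).
  by apply: (measurableT_comp (measurable_powlog _ _)); exact: measurableT_comp.
apply: ge0_le_integral => //.
- by move=> w _; rewrite lee_fin powlog_ge0.
- exact/measurable_EFinP.
- exact/measurable_EFinP.
move=> w _; rewrite lee_fin ler_wpM2l ?powR_ge0// ler_powR ?Llog_ge1//.
by rewrite lerN2 ler_pM2r// (lt_trans ltr01 a1).
Qed.

End moments.

(** The sequence a n / n tends to 0, as n^(1/alpha - 1) (log n)^b does; half of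
    the exponent, [s], absorbs the logarithm, and [y] is the index from which
    the remaining power contradicts a nonzero [m]. *)
Lemma mean_zero (R : realType) (alpha b m C : R) : 1 < alpha ->
  (exists N, forall n, (N <= n)%N -> n%:R * `|m| <= C * powlog alpha^-1 b n%:R) ->
  m = 0.
Proof.
move=> a1 [N NP]; apply/eqP; rewrite -normr_le0 leNgt; apply/negP => m0.
have a0 : 0 < alpha by lra.
pose s := (alpha^-1 - 1) / 2.
have s0 : s < 0.
  by rewrite /s pmulr_llt0 ?invr_gt0// subr_lt0 invf_lt1.
have [K K0 KP] := powlog_decr b s0.
pose B := `|C| * (K * powlog s b 1).
pose y := ((B + 1) / `|m|) `^ (- s)^-1.
have B0 : 0 <= B by rewrite mulr_ge0// mulr_ge0 ?powlog_ge0// ltW.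
pose n := maxn N (Num.truncn y).+1.
have yn : y <= n%:R.
  apply: (@le_trans _ _ (Num.truncn y).+1%:R).
    by rewrite ltW// truncnS_gt.
  by rewrite ler_nat leq_maxr.
have n1 : (1 <= n)%N by rewrite /n leq_max orbT.
have n1R : 1 <= n%:R :> R by rewrite ler1n.
have n0 : 0 < n%:R :> R by rewrite ltr0n.
have := NP n (leq_maxl _ _).
have -> : powlog alpha^-1 b n%:R = n%:R * (n%:R `^ s * powlog s b n%:R).
  have xs (x z : R) : n%:R `^ x * n%:R `^ z = n%:R `^ (x + z).
    by rewrite powRD// (gt_eqF n0) implybT.
  rewrite /powlog !mulrA -[X in X * _ * _ * _](@powRr1 _ n%:R) ?(ltW n0)// !xs.
  by congr (_ `^ _ * _); rewrite /s; lra.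
rewrite mulrCA ler_pM2l// => h.
have h1 : `|m| <= n%:R `^ s * B.
  rewrite (le_trans h)// mulrCA ler_wpM2l ?powR_ge0//.
  rewrite (@le_trans _ _ (`|C| * powlog s b n%:R))//.
    by rewrite ler_wpM2r ?powlog_ge0// ler_norm.
  by rewrite ler_wpM2l// KP.
have h2 : (B + 1) / `|m| <= n%:R `^ (- s).
  have -> : (B + 1) / `|m| = y `^ (- s).
    rewrite /y -powRrM mulVf ?gt_eqF ?oppr_gt0// powRr1//.
    by rewrite divr_ge0// addr_ge0.
  apply: ge0_ler_powR; rewrite ?nnegrE ?powR_ge0 ?(ltW n0)//.
  by rewrite oppr_ge0 ltW.
move: h2; rewrite powRN ler_pdivrMr// mulrC ler_pdivlMr ?powR_gt0//.
rewrite mulrDl mul1r (mulrC B) => h2.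
have := powR_gt0 s n0; lra.
Qed.

(** * The characterization *)

(* The terms n < 3 of the sequence, where log (log n) is not positive or not
   defined, have no influence on the limit superior. *)
Theorem theorem2p3 (R : realType) (alpha beta : R)
    (halpha1 : 1 < alpha) (halpha2 : alpha < 2)
    (d : measure_display) (T : measurableType d) (P : probability T R)
    (X : nat -> {RV P >-> R}) (hX : iid X) :
  {ae P, forall w,
    limn_esup (fun n : nat =>
      (`| partial_sum X n w / (n%:R `^ alpha^-1) | `^ (ln (ln n%:R))^-1)%:E)
    = (expR beta)%:E}
  <->
  (P.-integrable [set: T] (EFin \o X 0%N) /\ ('E_P[X 0%N] = 0)%E) /\
  ereal_inf [set b%:E | b in
    [set b : R | ('E_P[fun w => (`|X 0%N w| `^ alpha
                         / Llog `|X 0%N w| `^ (b * alpha))%R] < +oo)%E]]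
  = beta%:E.
Proof.
pose moment b := (\int[P]_w (powlog alpha (- (b * alpha)) `|X 0%N w|)%:E < +oo)%E.
rewrite (_ : [set b : R | _] = [set b | moment b]); last first.
  by apply/funext => b /=; rewrite moment_expectationE.
pose L w := limn_esup (fun n : nat =>
  (`| partial_sum X n w / (n%:R `^ alpha^-1) | `^ (ln (ln n%:R))^-1)%:E).
have lower b : ~ moment b -> {ae P, forall w, ((expR b)%:E <= L w)%E}.
  move=> nm; apply: filterS (partial_sums_exceed halpha1 hX nm) => w.
  exact: root_limsup_ge.
have upper b b' : moment b -> b < b' -> 'E_P[X 0%N]%E = 0%E ->
    {ae P, forall w, (L w <= (expR b')%:E)%E}.
  move=> mb bb' EX; have [C C0] := marcinkiewicz_zygmund halpha1 halpha2 hX mb.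
  apply: filterS => w [N NP]; apply: (root_limsup_le C0 bb'); exists N => n /NP.
  by rewrite EX mulr0 subr0.
split=> [aeL0|[[iX EX] infE]].
  have aeL : {ae P, forall w, L w = (expR beta)%:E} := aeL0.
  have mom b : beta < b -> moment b.
    move=> bb; apply: contrapT => /lower lo.
    have [w [Lw]] : exists w, L w = (expR beta)%:E /\ ((expR b)%:E <= L w)%E.
      by apply: (@ae_exists _ _ _ P); apply: filterS2 aeL lo.
    by rewrite Lw lee_fin ler_expR leNgt bb.
  have mb1 : moment (beta + 1) by apply: mom; rewrite ltrDl.
  have iX := moment_integrable halpha1 mb1.
  (* Almost surely S_n - n mu is O(a n), and |S_n| <= a n eventually because
     the upper limit is below e^(beta + 1); hence n mu is O(a n). *)
  have EX : 'E_P[X 0%N]%E = 0%E.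
    have [C C0 mz] := marcinkiewicz_zygmund halpha1 halpha2 hX mb1.
    have [w [Lw [N NP]]] : exists w, L w = (expR beta)%:E /\
        exists N, forall n, (N <= n)%N ->
          `|partial_sum X n w - n%:R * fine 'E_P[X 0%N]%E| <=
            C * powlog alpha^-1 (beta + 1) n%:R.
      by apply: (@ae_exists _ _ _ P); apply: filterS2 aeL mz.
    have fE : fine 'E_P[X 0%N]%E = 0.
      apply: (@mean_zero _ alpha (beta + 1) _ (C + 1) halpha1).
      have [N' N'P] : exists N', forall n, (N' <= n)%N ->
          `|partial_sum X n w| <= powlog alpha^-1 (beta + 1) n%:R.
        apply: contrapT => none.
        have : ((expR (beta + 1))%:E <= L w)%E.
          apply: root_limsup_ge => N'; apply: contrapT => none2; apply: none.
          exists N' => n Nn; rewrite leNgt; apply/negP => h; apply: none2.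
          by exists n.
        by rewrite Lw lee_fin ler_expR gerDl ler10.
      exists (maxn N N') => n; rewrite geq_max => /andP[nN nN'].
      rewrite mulrDl mul1r -[X in X * _](@normr_nat R) -normrM.
      have -> : n%:R * fine 'E_P[X 0%N]%E = partial_sum X n w -
         (partial_sum X n w - n%:R * fine 'E_P[X 0%N]%E) by rewrite subKr.
      by rewrite (le_trans (ler_normB _ _))// addrC lerD ?NP ?N'P.
    by rewrite -(@fineK _ 'E_P[X 0%N]%E) ?fE// unlock integrable_fin_num.
  split; first by split.
  apply/eqP; rewrite eq_le; apply/andP; split.
    apply/lee_addgt0Pr => e e0; apply: ereal_inf_lbound.
    by exists (beta + e); [apply: mom; rewrite ltrDl|].
  apply: le_ereal_inf_tmp => _ [b /= mb <-]; rewrite lee_fin leNgt.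
  apply/negP => bb; have bm : b < (b + beta) / 2 by lra.
  have [w [Lw]] : exists w, L w = (expR beta)%:E /\
      (L w <= (expR ((b + beta) / 2))%:E)%E.
    by apply: (@ae_exists _ _ _ P); apply: filterS2 aeL (upper _ _ mb bm EX).
  by rewrite Lw lee_fin ler_expR; lra.
have mom b : beta < b -> moment b.
  move=> bb; have : (ereal_inf [set b%:E | b in [set b | moment b]] < b%:E)%E.
    by rewrite infE lte_fin.
  move=> /ereal_inf_lt[_ [c /= mc <-]]; rewrite lte_fin => cb.
  by apply: (moment_mono halpha1 (ltW cb)).
have nmom b : b < beta -> ~ moment b.
  move=> bb mb; have : (ereal_inf [set b%:E | b in [set b | moment b]] <= b%:E)%E.
    by apply: ereal_inf_lbound; exists b.
  by rewrite infE lee_fin leNgt bb.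
(* The bounds hold almost surely for each exponent beta + 1/(k + 1) and
   beta - 1/(k + 1), hence almost surely for all of them. *)
have step k : 0 < k.+1%:R^-1 :> R by rewrite invr_gt0.
have up : {ae P, forall w, forall k, (L w <= (expR (beta + k.+1%:R^-1))%:E)%E}.
  apply: ae_foralln => k.
  apply: (upper (beta + k.+1%:R^-1 / 2)) => //.
    by apply: mom; rewrite ltrDl divr_gt0.
  by rewrite ltrD2l ltr_pdivrMr// ltr_pMr// ltr1n.
have lo : {ae P, forall w, forall k, ((expR (beta - k.+1%:R^-1))%:E <= L w)%E}.
  by apply: ae_foralln => k; apply: lower; apply: nmom; rewrite gtrBl.
apply: filterS2 up lo => w upw low; change (L w = (expR beta)%:E).
have [r Lr] : exists r, L w = r%:E.
  have := upw 0%N; have := low 0%N.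
  by case: (L w) => [r _ _| |]; [exists r|rewrite leye_eq|rewrite leeNy_eq].
have r0 : 0 < r.
  by have := low 0%N; rewrite Lr lee_fin; apply: lt_le_trans; rewrite expR_gt0.
rewrite Lr; congr _%:E; rewrite -[LHS]lnK//; congr expR.
apply/eqP; rewrite eq_le !leNgt; apply/andP; split; apply/negP => /ltr_add_invr[k].
  rewrite -ltr_expR lnK// => rk; have := upw k.
  by rewrite Lr lee_fin leNgt rk.
rewrite -ltrBrDr -ltr_expR lnK// => rk; have := low k.
by rewrite Lr lee_fin leNgt rk.
Qed.
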